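(* Let $X$ be a real Banach space, $\partial$ a subdifferential on $X$ (in the sense defined in the context), and $\Omega\subset X$ a nonempty open convex subset. Let $f,g:X\to\,]-\infty,+\infty]$ be proper lower semicontinuous functions with $\Omega\cap\operatorname{dom} f\neq\emptyset$. Assume that for every $\bar x\in\Omega\cap\operatorname{dom}\partial f\cap\operatorname{dom}\partial g$ and every $u\in X$, $u\ne0$, with $\bar x+u\in\Omega\cap\operatorname{dom} f\cap\operatorname{dom} g$, the points $\bar x_t:=\bar x+tu$ satisfy the following properties: (1) $t\mapsto g(\bar x_t)$ is (finite and) continuous on $[0,1]$; (2) for every $t\in[0,1[$, either $f^r(\bar x_t;u)$ or $g^r(\bar x_t;u)$ is finite, and either (a) or (b) holds: (a) $f$ is radially accessible at $\bar x_t$ from $u$ and $g$ is upper semismooth at $\bar x_t$ in the direction $u$; (b) $g$ is strictly upper semismooth at $\bar x_t$ in the direction $u$. Then: if $\partial f(x)\subset\partial g(x)$ for all $x\in\Omega\cap\operatorname{dom} f$, there is a real constant $c$ such that $f=g+c$ on $\Omega\cap\operatorname{dom} f$.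
   Context: $X$ is a real Banach space, $X^*$ its topological dual, $\langle\cdot,\cdot\rangle$ the duality pairing. For $f:X\to\,]-\infty,+\infty]$, $\operatorname{dom} f=\{x: f(x)<+\infty\}$; $f$ is proper if $\operatorname{dom} f\ne\emptyset$; lsc means lower semicontinuous. Subderivatives (defined only at points of the domain of the function): for lsc $f$, $x\in\operatorname{dom} f$, $u\in X$, $$f^r(x;u)=\liminf_{t\searrow0}\frac{f(x+tu)-f(x)}{t},\qquad f^\uparrow(x;u)=\sup_{\delta>0}\ \limsup_{t\searrow 0,\ (y,f(y))\to(x,f(x))}\ \inf_{u'\in B_\delta(u)}\frac{f(y+tu')-f(y)}{t},$$ with values in $[-\infty,+\infty]$, where $B_\delta(u)$ is the ball of center $u$ and radius $\delta$. The phrase ''$f^r(x;u)$ is finite'' includes $x\in\operatorname{dom} f$. Subdifferentials: for $x\in\operatorname{dom} f$ let $\partial_{MR}f(x)=\{x^*\in X^*:\langle x^*,y-x\rangle+f(x)\le f(y)\ \forall y\in X\}$ and $\partial_C f(x)=\{x^*\in X^*:\langle x^*,v\rangle\le f^\uparrow(x;v)\ \forall v\in X\}$; all subdifferentials are empty at points outside $\operatorname{dom} f$. A subdifferential on $X$ is any operator $\partial$ that associates to each proper lsc $f:X\to\,]-\infty,+\infty]$ a set-valued mapping $\partial f:X\rightrightarrows X^*$ (identified with its graph in $X\times X^*$) such that $\partial_{MR}f(x)\subset\partial f(x)\subset\partial_Cf(x)$ for all $x$ and the following Separation Principle holds: for any lsc $f,\varphi$ with $\varphi$ convex Lipschitz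 near $\bar x\in\operatorname{dom} f$, if $f+\varphi$ has a local minimum at $\bar x$, then $0\in\widehat\partial f(\bar x)+\partial\varphi(\bar x)$, where $\widehat\partial f(\bar x)$ is the set of $\bar x^*\in X^*$ for which there is a net $((x_\nu,x_\nu^* ))_\nu\subset\partial f$ with $(x_\nu,f(x_\nu))\to(\bar x,f(\bar x))$, $x_\nu^*\to\bar x^*$ in the weak-star topology, and $\limsup_\nu\langle x^*_\nu,x_\nu-\bar x\rangle\le0$. Write $\operatorname{dom}\partial f=\{x:\partial f(x)\neq\emptyset\}$. Directional convergence: $x_n\to_v\bar x$ means there are $t_n>0$, $t_n\to0$, and $v_n\to v$ with $x_n=\bar x+t_nv_n$ for all $n$ (for $v=0$ this is just $x_n\to\bar x$, and $x_n=\bar x$ is allowed). $\limsup_{x\to_v\bar x}F(x)$, for $F$ defined on $\operatorname{dom} g$, is the supremum of $\limsup_nF(x_n)$ over all sequences $x_n\to_v\bar x$ in $\operatorname{dom} g$ ($-\infty$ if there are none); $\limsup_{x\to\bar x}$ is the case $v=0$. $f$ is radially accessible at $\bar x\in\operatorname{dom} f$ from $u$ if $f(\bar x)=\liminf_{t\searrow0}f(\bar x+tu)$. A lsc function $g$ is upper semismooth at $\bar x\in\operatorname{dom} g$ in the direction $u$ if $\inf_{\alpha\ge0}\limsup_{x\to_u\bar x}g^r(x;u+\alpha(\bar x-x))\le g^r(\bar x;u)$; it is strictly upper semismooth at $\bar x$ in the direction $u$ if $\inf_{\alpha\ge0}\limsup_{x\to\bar x}g^r(x;u+\alpha(\bar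 x-x))\le g^r(\bar x;u)$. *)

(* Defs.v *)
(* A function X -> ]-oo, +oo] is a map f : X -> \bar R satisfying [no_ninfty f]. *)
From HB Require Import structures.
From mathcomp Require Import all_boot all_order all_algebra.
From mathcomp Require Import all_classical all_reals all_analysis.

Set Implicit Arguments.
Unset Strict Implicit.
Unset Printing Implicit Defensive.

Import Order.TTheory GRing.Theory Num.Theory.
Import numFieldNormedType.Exports.

Local Open Scope classical_set_scope.
Local Open Scope ring_scope.

Record dual (R : realType) (X : normedModType R) := Dual {
  dual_fun :> {linear X -> R^o};
  dual_continuous : continuous (dual_fun : X -> R^o) }.

Definition no_ninfty (R : realType) (X : Type) (f : X -> \bar R) : Prop :=
  forall x, (-oo < f x)%E.

Definition edom (R : realType) (X : Type) (f : X -> \bar R) : set X :=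
  [set x | (f x < +oo)%E].

Definition proper_lsc (R : realType) (X : normedModType R)
    (f : X -> \bar R) : Prop :=
  [/\ no_ninfty f, edom f !=set0 & lower_semicontinuous f].

Definition diffquot (R : realType) (X : normedModType R)
    (f : X -> \bar R) (x u : X) (t : R) : \bar R :=
  ((f (x + t *: u)%R - f x) * (t^-1)%:E)%E.

(* Meaningful only for x in [edom f]: elsewhere [diffquot] is a junk value.
   The same holds for [upsubder] below. *)
Definition radsubder (R : realType) (X : normedModType R)
    (f : X -> \bar R) (x u : X) : \bar R :=
  limf_einf (diffquot f x u) 0^'+.

Definition radsubder_finite (R : realType) (X : normedModType R)
    (f : X -> \bar R) (x u : X) : Prop :=
  edom f x /\ radsubder f x u \is a fin_num.

(* The filter of (y, f y) --> (x, f x), pulled back to a filter on y. *)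
Definition graph_nbhs (R : realType) (X : normedModType R)
    (f : X -> \bar R) (x : X) : set_system X :=
  filter_from (nbhs (x, f x)) (fun B => [set y | B (y, f y)]).

Definition upsubder (R : realType) (X : normedModType R)
    (f : X -> \bar R) (x u : X) : \bar R :=
  ereal_sup [set limf_esup
      (fun ty : R * X =>
        ereal_inf [set diffquot f ty.2 u' ty.1 | u' in ball u delta])
      (filter_prod 0^'+ (graph_nbhs f x))
    | delta in [set delta : R | 0 < delta]].

Definition subdiff_MR (R : realType) (X : normedModType R)
    (f : X -> \bar R) (x : X) : set (dual X) :=
  [set xs | edom f x /\
    forall y : X, ((xs (y - x))%:E + f x <= f y)%E].

Definition subdiff_C (R : realType) (X : normedModType R)
    (f : X -> \bar R) (x : X) : set (dual X) :=
  [set xs | edom f x /\ forall v : X, ((xs v)%:E <= upsubder f x v)%E].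

Definition directed (I : Type) (le : I -> I -> Prop) : Prop :=
  [/\ inhabited I, (forall i, le i i),
      (forall i j k, le i j -> le j k -> le i k) &
      (forall i j, exists2 k, le i k & le j k)].

Definition tails (I : Type) (le : I -> I -> Prop) : set_system I :=
  filter_from setT (fun i => [set j | le i j]).

(* The formula of [limf_esup], which cannot be used here because it requires a
   [filteredType] structure on the index type. *)
Definition net_limsup (R : realType) (I : Type) (le : I -> I -> Prop)
    (h : I -> \bar R) : \bar R :=
  ereal_inf [set ereal_sup (h @` A) | A in tails le].

Definition subdiff_operator (R : realType) (X : normedModType R) :=
  (X -> \bar R) -> X -> set (dual X).

(* Weak-star convergence of a net in the dual is pointwise convergence. *)
Definition subdiff_hat (R : realType) (X : normedModType R)
    (D : subdiff_operator X) (f : X -> \bar R) (x : X) : set (dual X) :=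
  [set xs | exists (I : Type) (le : I -> I -> Prop)
                   (y : I -> X) (ys : I -> dual X),
    [/\ directed le,
        forall i, D f (y i) (ys i),
        (y i, f (y i)) @[i --> tails le] --> (x, f x),
        forall v : X, ys i v @[i --> tails le] --> xs v &
        (net_limsup le (fun i => (ys i (y i - x))%:E) <= 0)%E]].

Definition econvex (R : realType) (X : normedModType R)
    (phi : X -> \bar R) : Prop :=
  forall (x y : X) (t : R), 0 <= t <= 1 ->
    (phi (t *: x + (1 - t) *: y)%R
       <= t%:E * phi x + (1 - t)%:E * phi y)%E.

Definition lipschitz_near (R : realType) (X : normedModType R)
    (phi : X -> \bar R) (x : X) : Prop :=
  exists U : set X, [/\ nbhs x U,
    forall y, U y -> phi y \is a fin_num &
    [lipschitz (fine (phi y) : R^o) | y in U]].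

Definition separation_principle (R : realType) (X : normedModType R)
    (D : subdiff_operator X) : Prop :=
  forall (f phi : X -> \bar R) (x : X),
    no_ninfty f -> lower_semicontinuous f -> edom f x ->
    no_ninfty phi -> lower_semicontinuous phi ->
    econvex phi -> lipschitz_near phi x ->
    (\forall y \near x, (f x + phi x <= f y + phi y)%E) ->
    exists xs ys : dual X,
      [/\ subdiff_hat D f x xs, D phi x ys & forall v : X, 0 = xs v + ys v].

(* The values of D outside proper lsc functions are irrelevant. *)
Definition is_subdifferential (R : realType) (X : normedModType R)
    (D : subdiff_operator X) : Prop :=
  (forall f : X -> \bar R, proper_lsc f -> forall x : X,
     subdiff_MR f x `<=` D f x /\ D f x `<=` subdiff_C f x) /\
  separation_principle D.

Definition subdiff_dom (R : realType) (X : normedModType R)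
    (D : subdiff_operator X) (f : X -> \bar R) : set X :=
  [set x | D f x !=set0].

Definition dir_cvg (R : realType) (X : normedModType R)
    (v : X) (x : nat -> X) (xbar : X) : Prop :=
  exists (t : nat -> R) (w : nat -> X),
    [/\ forall n, 0 < t n, t @ \oo --> (0 : R), w @ \oo --> v &
        forall n, x n = xbar + t n *: w n].

Definition dir_limsup (R : realType) (X : normedModType R)
    (g : X -> \bar R) (v xbar : X) (F : X -> \bar R) : \bar R :=
  ereal_sup [set limn_esup (F \o x) | x in
    [set x : nat -> X | dir_cvg v x xbar /\ forall n, edom g (x n)]].

Definition radially_accessible (R : realType) (X : normedModType R)
    (f : X -> \bar R) (xbar u : X) : Prop :=
  edom f xbar /\ f xbar = limf_einf (fun t : R => f (xbar + t *: u)) 0^'+.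

Definition upper_semismooth (R : realType) (X : normedModType R)
    (g : X -> \bar R) (xbar u : X) : Prop :=
  edom g xbar /\
  (ereal_inf [set dir_limsup g u xbar
                    (fun x => radsubder g x (u + alpha *: (xbar - x))%R)
             | alpha in [set alpha : R | (0 <= alpha)%R]]
     <= radsubder g xbar u)%E.

Definition strictly_upper_semismooth (R : realType) (X : normedModType R)
    (g : X -> \bar R) (xbar u : X) : Prop :=
  edom g xbar /\
  (ereal_inf [set dir_limsup g 0%R xbar
                    (fun x => radsubder g x (u + alpha *: (xbar - x))%R)
             | alpha in [set alpha : R | (0 <= alpha)%R]]
     <= radsubder g xbar u)%E.

(* Main.v *)
(* Idea. On a segment starting at a point xbar of dom D f, one shows
   f^r(.;u) <= g^r(.;u) at every point of dom f; since f - g is lsc on the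
   segment, its lower right Dini derivative being nonpositive makes it
   nonincreasing. Hence f - g is a constant c on Omega /\ dom D f and at most c
   on Omega /\ dom f /\ dom g; the graph density of dom D f and the lower
   semicontinuity of g give the reverse inequality.

   The inequality of radial subderivatives has two halves. Below: a Zagrodny
   type mean value inequality, obtained from Ekeland's principle and the
   separation principle applied to a penalization of the distance to a ray,
   yields x* in D f(x), x near xbar, with <x*, u + alpha (xbar - x)> almost
   f^r(xbar;u). Above: such an x* belongs to the Clarke subdifferential of g at
   x, and a descent argument along the vector field v = u + alpha (xbar - .)
   bounds g^up(x;v(x)) by the values of g^r(x';v(x')) for x' near x, which upper
   semismoothness bounds in turn by g^r(xbar;u). *)
Require Import Defs.
From HB Require Import structures.
From mathcomp Require Import all_boot all_order all_algebra.
From mathcomp Require Import all_classical all_reals all_analysis.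
From mathcomp Require Import ring lra.

Set Implicit Arguments.
Unset Strict Implicit.
Unset Printing Implicit Defensive.

Import Order.TTheory GRing.Theory Num.Theory.
Import numFieldNormedType.Exports.

Local Open Scope classical_set_scope.
Local Open Scope ring_scope.

(** * An ordering principle and descent in a complete space *)

(** Brezis-Browder ordering principle: each new term of a sequence nearly attains the supremum of
    [psi] over the successors of the previous one, with tolerance tending to 0, so above an upper
    bound of the whole sequence [psi] cannot grow. Only sequences have to be bounded above, so
    dependent choice suffices. *)
Lemma brezis_browder (R : realType) (Y : Type) (le : Y -> Y -> Prop)
    (psi : Y -> R) (M : R) (y0 : Y) :
  (forall y, le y y) -> (forall y x z, le x y -> le y z -> le x z) ->
  (forall x y, le x y -> psi x <= psi y) ->
  (forall y, le y0 y -> psi y <= M) ->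
  (forall s : nat -> Y, s 0%N = y0 -> (forall n, le (s n) (s n.+1)) ->
     exists y, forall n, le (s n) y) ->
  exists2 y, le y0 y & forall z, le y z -> psi z = psi y.
Proof.
move=> lexx letr psi_mono psi_bd seq_ub.
(* Dependent choice needs a relation that never gets stuck, so [le y0 p.2], which makes [psi]
   bounded above [p.2], is a premise; the counter in the first component sets the tolerance. *)
have step (p : nat * Y) : {q : nat * Y | le y0 p.2 ->
    [/\ q.1 = p.1.+1, le p.2 q.2 &
     forall z, le p.2 z -> psi z <= psi q.2 + p.1.+1%:R^-1]}.
  apply: cid; case: p => n y /=.
  have [y0y|] := pselect (le y0 y); last by move=> Ny; exists (n, y).
  have supA : has_sup (psi @` [set z | le y z]).
    split; first by exists (psi y), y => //; exact: lexx.
    by exists M => _ [z /= yz <-]; apply: psi_bd; exact: letr yz.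
  have n0 : 0 < n.+1%:R^-1 :> R by rewrite invr_gt0.
  have [_ [z /= yz <-] zsup] := sup_adherent n0 supA.
  exists (n.+1, z) => _; split => // x yx.
  rewrite -lerBlDr; apply: le_trans (ltW zsup); rewrite lerD2r.
  by apply: (sup_upper_bound supA); exists x.
have [s [s0 sS]] := @dependent_choice _
  (fun p q : nat * Y => le y0 p.2 -> [/\ q.1 = p.1.+1, le p.2 q.2 &
     forall z, le p.2 z -> psi z <= psi q.2 + p.1.+1%:R^-1]) step (0%N, y0).
have y0s n : le y0 (s n).2 /\ (s n).1 = n.
  elim: n => [|n [ys sn]]; first by rewrite s0.
  have [-> sle _] := sS n ys.
  by rewrite sn; split => //; exact: letr sle.
have [y sy] : exists y, forall n, le (s n).2 y.
  by apply: seq_ub => [|n]; [rewrite s0|have [] := sS n (y0s n).1].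
exists y => [|z yz]; first by have := sy 0%N; rewrite s0.
apply/eqP; rewrite eq_le (psi_mono _ _ yz) andbT.
apply/ler_addgt0Pr => e e0.
have [n ne] : exists n : nat, n.+1%:R^-1 < e.
  have := @near_infty_natSinv_lt R (PosNum e0).
  by case=> N _ /(_ N) /= H; exists N; apply: H.
have [ys sn] := y0s n.
have [_ _ /(_ z (letr _ _ _ (sy n) yz))] := sS n ys.
rewrite sn => /le_trans; apply; apply: lerD; last exact: ltW.
exact: psi_mono.
Qed.

Lemma cvgn_dominated_increments (R : realType) (X : completeNormedModType R)
    (z : nat -> X) (r : nat -> R) :
  (forall n m, (n <= m)%N -> `|z m - z n| <= r m - r n) ->
  cvgn r -> cvgn z.
Proof.
move=> zr /cvgP/cvg_ex[l rl]; apply: cauchy_cvg; apply: cauchy_exP => e e0.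
have e2 : 0 < e / 2 by rewrite divr_gt0.
move/cvgrPdist_lt : rl => /(_ _ e2) [N _ HN].
exists (z N); exists N => // n /= Nn.
rewrite -ball_normE /= distrC; apply: le_lt_trans (zr _ _ Nn) _.
have := HN n Nn; have := HN N (leqnn N).
by rewrite /= !ltr_norml => /andP[? ?] /andP[? ?]; lra.
Qed.

Lemma lsc_le_cvg (R : realType) (X : topologicalType) (g : X -> \bar R)
    (z : nat -> X) (x : X) (r : nat -> R) (l : R) :
  lower_semicontinuous g -> z @ \oo --> x -> r @ \oo --> l ->
  (\forall n \near \oo, (g (z n) <= (r n)%:E)%E) -> (g x <= l%:E)%E.
Proof.
move=> gl zx rl gr; rewrite leNgt; apply/negP => lg.
have [a la ag] : exists2 a : R, l < a & (a%:E < g x)%E.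
  case: (g x) lg => [b| |] //=; last by move=> _; exists (l + 1); [lra|rewrite ltry].
  by rewrite lte_fin => lb; exists ((l + b) / 2); rewrite ?lte_fin; lra.
have [V xV VP] := gl _ _ ag.
have zV : \forall n \near \oo, V (z n) by exact: zx.
have ra : \forall n \near \oo, r n < a.
  exact: (cvgr_lt l rl).
have [N _ HN] : \forall n \near \oo, False.
  near=> n.
  have : (a%:E < (r n)%:E)%E.
    by apply: (@lt_le_trans _ _ (g (z n))); [apply: VP; near: n|near: n].
  rewrite lte_fin => /lt_trans.
  have rna : r n < a by near: n.
  by move=> /(_ _ rna); rewrite ltxx.
exact: (HN N (leqnn N)).
Unshelve. all: by end_near. Qed.

(* For [w = 0] and [lambda < 0] this is Ekeland's principle. In general, if [g]
   can decrease at rate [lambda] in a direction close to [w] around [z0], then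
   maximality forces [s = T]. *)
Lemma descent (R : realType) (X : completeNormedModType R) (g : X -> \bar R)
    (z0 w : X) (delta lambda T : R) :
  no_ninfty g -> lower_semicontinuous g -> edom g z0 -> 0 <= T ->
  exists (z : X) (s : R),
    [/\ 0 <= s <= T, `|z - z0 - s *: w| <= delta * s,
        (g z <= g z0 + (lambda * s)%:E)%E &
        forall (z' : X) (tau : R), 0 < tau -> s + tau <= T ->
          `|z' - z - tau *: w| <= delta * tau ->
          (g z + (lambda * tau)%:E < g z')%E].
Proof.
move=> gN gl gz0 T0.
(* The second component is a time. The third clause confines the position to a cone of aperture
   [delta] around the velocity [w]; the second carries the bound [T] along chains that start at time
   0. *)
pose le (p q : X * R) := [/\ p.2 <= q.2, (p.2 <= T -> q.2 <= T),
  `|q.1 - p.1 - (q.2 - p.2) *: w| <= delta * (q.2 - p.2) &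
  (g q.1 <= g p.1 + (lambda * (q.2 - p.2))%:E)%E].
have lexx p : le p p.
  by split => //; rewrite !subrr ?scale0r ?subr0 ?normr0 mulr0 ?adde0.
have letr q p r : le p q -> le q r -> le p r.
  move=> [pq1 pq2 pq3 pq4] [qr1 qr2 qr3 qr4]; split.
  - exact: le_trans qr1.
  - by move/pq2/qr2.
  - have -> : r.1 - p.1 - (r.2 - p.2) *: w =
      (r.1 - q.1 - (r.2 - q.2) *: w) + (q.1 - p.1 - (q.2 - p.2) *: w).
      have -> : r.2 - p.2 = (r.2 - q.2) + (q.2 - p.2) by ring.
      rewrite scalerDl addrACA opprD; congr (_ + _).
      by rewrite addrA subrK.
    apply: le_trans (ler_normD _ _) _.
    by apply: le_trans (lerD qr3 pq3) _; rewrite -mulrDr; rewrite (_ : r.2 - q.2 + (q.2 - p.2) = r.2 - p.2) //; ring.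
  - apply: (le_trans qr4).
    have -> : (lambda * (r.2 - p.2)) =
      (lambda * (q.2 - p.2)) + (lambda * (r.2 - q.2)) by ring.
    by rewrite EFinD addeA leeD2r.
have := @brezis_browder R _ le (fun p => p.2) T (z0, 0) lexx letr.
case.
- by move=> ? ? [].
- by move=> p [_ /(_ T0)].
- move=> s s0 sS.
  have sle : {homo s : n m / (n <= m)%N >-> le n m} by exact: homo_leq sS.
  have sT n : (s n).2 <= T.
    by have [_ + _ _] := sle _ _ (leq0n n); rewrite s0; apply.
  have cs : cvgn (fun n => (s n).2).
    apply: nondecreasing_is_cvgn; first by move=> n m nm; have [] := sle _ _ nm.
    by exists T => _ [n _ <-]; exact: sT.
  (* Once the drift [s *: w] is subtracted, the increments are dominated by those of [delta * s],
     which converges. *)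
  have cz : cvgn (fun n => (s n).1 - (s n).2 *: w).
    apply: (@cvgn_dominated_increments _ _ _ (fun n => delta * (s n).2)); last first.
      by apply: is_cvgM => //; exact: is_cvg_cst.
    move=> n m nm; have [_ _ + _] := sle _ _ nm.
    rewrite mulrBr scalerBl.
    by rewrite opprD opprK addrACA -(opprK ((s n).2 *: w)) -opprD opprK.
  pose sl := limn (fun n => (s n).2).
  have csl : (s n).2 @[n --> \oo] --> sl by exact: cs.
  pose zl := limn (fun n => (s n).1 - (s n).2 *: w) + sl *: w.
  have czl : (s n).1 @[n --> \oo] --> zl.
    have -> : (fun n => (s n).1) = (fun n => ((s n).1 - (s n).2 *: w) + (s n).2 *: w).
      by apply/funext => n; rewrite subrK.
    by apply: cvgD => //; apply: cvgZr_tmp.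
  exists (zl, sl) => n; split => /=.
  + by apply: nondecreasing_cvgn_le => // i j ij; have [] := sle _ _ ij.
  + by move=> _; apply: limr_le => //; near=> m.
  + apply: (@ler_cvg_to _ \oo _ _ (fun m => `|(s m).1 - (s n).1 - ((s m).2 - (s n).2) *: w|)
      (fun m => delta * ((s m).2 - (s n).2))).
    * apply: cvg_norm; apply: cvgB; first by apply: cvgB => //; exact: cvg_cst.
      by apply: cvgZr_tmp; apply: cvgB => //; exact: cvg_cst.
    * by apply: cvgMr; apply: cvgB => //; exact: cvg_cst.
    * by exists n => // m /= nm; have [] := sle _ _ nm.
  + have := gN (s n).1; case E : (g (s n).1) => [a| |] // _; last by rewrite addye// leey.
    rewrite -EFinD; apply: (lsc_le_cvg gl czl (r := fun m => a + lambda * ((s m).2 - (s n).2))).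
      apply: cvgD; first exact: cvg_cst.
      by apply: cvgMr; apply: cvgB => //; exact: cvg_cst.
    by exists n => // m /= nm; have [_ _ _] := sle _ _ nm; rewrite E -EFinD.
move=> [z s] /= [/= s0 sT zs gs] zmax; rewrite subr0 in zs gs.
exists z, s; split => //; first by rewrite s0 sT.
move=> z' tau tau0 stau dz; rewrite ltNge; apply/negP => gz'.
(* The potential is the time, so a further admissible step would increase it beyond its maximal
   value. *)
suff : le (z, s) (z', s + tau) by move/zmax => /=; lra.
have e : s + tau - s = tau by ring.
by split => /=; rewrite ?e// lerDl ltW.
Unshelve. all: by end_near. Qed.

(** * Radial limits and the upper subderivative *)

Lemma limf_einf_right_lt (R : realType) (h : R -> \bar R) (l : \bar R) (e : R) :
  (limf_einf h 0^'+ < l)%E -> 0 < e -> exists2 t, 0 < t < e & (h t < l)%E.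
Proof.
move=> hl e0; apply: contrapT => H.
move: hl; rewrite ltNge => /negP; apply; rewrite limf_einfE.
apply: (@le_trans _ _ (ereal_inf (h @` [set t | 0 < t < e]))).
  apply: le_ereal_inf_tmp => _ [t /= te <-].
  by rewrite leNgt; apply/negP => htl; apply: H; exists t.
apply: ereal_sup_ubound; exists [set t | 0 < t < e] => //.
near=> t => /=; apply/andP; split; near: t;
  [exact: nbhs_right_gt|exact: nbhs_right_lt].
Unshelve. all: by end_near. Qed.

Lemma limf_einf_right_gt (R : realType) (h : R -> \bar R) (l : \bar R) :
  (l < limf_einf h 0^'+)%E ->
  exists2 e : R, 0 < e & forall t, 0 < t < e -> (l < h t)%E.
Proof.
rewrite limf_einfE => /ereal_sup_gt[_ [A A0 <-] lA].
have [e /= e0 eA] := A0.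
exists e => // t /andP[t0 te]; apply: (lt_le_trans lA).
apply: ereal_inf_lbound; exists t => //; apply: eA => //=.
by rewrite sub0r normrN gtr0_norm.
Qed.

Lemma diffquot_lt (R : realType) (X : normedModType R) (f : X -> \bar R)
    (x u : X) (t r : R) : f x \is a fin_num -> 0 < t ->
  (diffquot f x u t < r%:E)%E = (f (x + t *: u)%R < f x + (r * t)%:E)%E.
Proof.
move=> fx t0; rewrite /diffquot EFinM lte_pdivrMr// lteBlDl//.
Qed.

Lemma diffquot_le (R : realType) (X : normedModType R) (f : X -> \bar R)
    (x u : X) (t r : R) : f x \is a fin_num -> 0 < t ->
  (diffquot f x u t <= r%:E)%E = (f (x + t *: u)%R <= f x + (r * t)%:E)%E.
Proof.
by move=> fx t0; rewrite /diffquot EFinM lee_pdivrMr// leeBlDl.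
Qed.

Lemma edom_fin_num (R : realType) (X : Type) (f : X -> \bar R) (x : X) :
  no_ninfty f -> edom f x -> f x \is a fin_num.
Proof. by move=> fN fx; rewrite fin_numE -ltey -ltNye fx fN. Qed.

(** Graph convergence keeps [f y] near the finite value [f x], hence below [+oo]. The base points in
    [upsubder] may thus be taken in the domain, where [descent] can start. *)
Lemma graph_nbhs_edom (R : realType) (X : normedModType R) (f : X -> \bar R)
    (x : X) (rho : R) : f x \is a fin_num -> 0 < rho ->
  graph_nbhs f x [set y | ball x rho y /\ edom f y].
Proof.
move=> fx rho0; exists (ball x rho `*` [set r : \bar R | (r < +oo)%E]) => //.
exists (ball x rho, [set r : \bar R | (r < +oo)%E]) => //=; split.
  exact: nbhsx_ballx.
apply: open_nbhs_nbhs; split; last by rewrite /= ltey; case: (f x) fx.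
exact: open_ereal_lt_ereal.
Qed.

(* The descent direction may follow any continuous field [v]; this is what
   allows [radsubder] to be evaluated along [u + alpha *: (xbar - _)]. *)
Lemma upsubder_le_radsubder (R : realType) (X : completeNormedModType R)
    (g : X -> \bar R) (v : X -> X) (x : X) (r rho : R) :
  no_ninfty g -> lower_semicontinuous g -> edom g x ->
  {for x, continuous v} -> 0 < rho -> (r%:E < upsubder g x (v x))%E ->
  exists x', [/\ ball x rho x', edom g x' & (r%:E <= radsubder g x' (v x'))%E].
Proof.
move=> gN gl gx vx rho0 rg; apply: contrapT => H.
move: rg; rewrite ltNge => /negP; apply.
apply: ge_ereal_sup => _ [delta /= delta0 <-].
have d2 : 0 < delta / 2 by rewrite divr_gt0.
have [e1 e10 ve] : exists2 e, 0 < e & forall y, ball x e y -> `|v y - v x| <= delta / 2.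
  have /cvgrPdist_le/(_ _ d2)/nbhs_ballP[e /= e0 He] := vx.
  by exists e => // y /He; rewrite distrC.
pose e := Num.min rho e1.
have e0 : 0 < e by rewrite lt_min rho0.
have gdec z : ball x e z -> edom g z -> (radsubder g z (v z) < r%:E)%E.
  move=> xz gz; rewrite ltNge; apply/negP => rg; apply: H.
  by exists z; split => //; apply: le_ball xz; rewrite ge_min lexx.
pose L := `|v x| + delta.
have L0 : 0 < L by rewrite ltr_wpDl.
(* A descent lasting less than [tmax] has speed at most [L], so from [ball x (e / 2)] it stays in
   [ball x e], where [gdec] holds. *)
pose tmax := e / 2 / L.
have tmax0 : 0 < tmax by rewrite !divr_gt0.
have e2 : 0 < e / 2 by rewrite divr_gt0.
pose A := [set ty : R * X | 0 < ty.1 < tmax /\ (ball x (e / 2) ty.2 /\ edom g ty.2)].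
apply: (@le_trans _ _ (ereal_sup ((fun ty : R * X =>
   ereal_inf [set diffquot g ty.2 u' ty.1 | u' in ball (v x) delta]) @` A))).
  apply: ereal_inf_lbound; exists A => //.
  exists ([set t | 0 < t < tmax], [set y | ball x (e / 2) y /\ edom g y]) => //=.
  split; last by apply: graph_nbhs_edom => //; exact: edom_fin_num.
  near=> t => /=; apply/andP; split; near: t;
    [exact: nbhs_right_gt|exact: nbhs_right_lt].
apply: ge_ereal_sup => _ [[t y] /= [/andP[t0 tt] [xy gy]] <-].
have [z [s [/andP[s0 st] zs gz zmax]]] :=
  descent (v x) (delta / 2) r gN gl gy (ltW t0).
have gzd : edom g z.
  by apply: (le_lt_trans gz); move: (edom_fin_num gN gy); case: (g y) => // a _; rewrite -EFinD ltry.
have zyL : `|z - y| <= s * L.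
  have -> : z - y = (z - y - s *: v x) + s *: v x by rewrite subrK.
  apply: le_trans (ler_normD _ _) _; rewrite normrZ (ger0_norm s0).
  by apply: le_trans (lerD zs (lexx _)) _; rewrite /L; nra.
have xz : ball x e z.
  rewrite -ball_normE /= -(subrK y x) -addrA.
  apply: le_lt_trans (ler_normD _ _) _.
  move: xy; rewrite -ball_normE /= => xy.
  have : s * L < e / 2.
    rewrite -ltr_pdivlMr//; apply: le_lt_trans st tt.
  rewrite (distrC y z); lra.
(* If [s = t], the mean velocity [t^-1 *: (z - y)] is an admissible [u'] with quotient at most [r].
   If [s < t], [gdec] at [z] gives a further step along [v z], which is within [delta / 2] of [v x],
   against maximality. *)
have [st'|st'] := ltP s t; last first.
  have {}st : s = t by apply/eqP; rewrite eq_le st.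
  subst s; apply: ge_ereal_inf; exists (diffquot g y (t^-1 *: (z - y)) t).
    exists (t^-1 *: (z - y)) => //; rewrite -ball_normE /= distrC.
    have -> : t^-1 *: (z - y) - v x = t^-1 *: (z - y - t *: v x).
      by rewrite [RHS]scalerBr scalerA mulVf ?scale1r// gt_eqF.
    rewrite normrZ gtr0_norm ?invr_gt0// mulrC ltr_pdivrMr//.
    by apply: (le_lt_trans zs); rewrite ltr_pM2r//; lra.
  rewrite diffquot_le//; last exact: edom_fin_num.
  by rewrite scalerA mulfV ?gt_eqF// scale1r addrC subrK.
have [tau /andP[tau0 taut]] := limf_einf_right_lt (gdec z xz gzd) (eqbRL (subr_gt0 _ _) st').
rewrite diffquot_lt//; last exact: edom_fin_num.
rewrite ltNge => /negP[]; apply/ltW; apply: zmax => //.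
  by rewrite -lerBrDl ltW.
have -> : z + tau *: v z - z - tau *: v x = tau *: (v z - v x).
  by rewrite scalerBr (addrC z) addrK.
rewrite normrZ gtr0_norm// mulrC ler_pM2r//; apply: ve.
by apply: le_ball xz; rewrite ge_min lexx orbT.
Unshelve. all: by end_near. Qed.

(** * Subgradients near approximate minima *)

Lemma tails_filter (I : Type) (le : I -> I -> Prop) :
  directed le -> ProperFilter (tails le).
Proof.
move=> [[i0] lexx letr ledir].
apply: filter_from_proper; last by move=> i _; exists i => /=; exact: lexx.
apply: filter_from_filter; first by exists i0.
move=> i j _ _; have [k ik jk] := ledir i j; exists k => // l /= kl.
by split; [exact: letr ik kl|exact: letr jk kl].
Qed.

(** Replaces the net by one of its elements. Weak-star convergence is tested on two vectors only,
    which is all that the mean value inequality asks for. *)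
Lemma subdiff_hat_approx (R : realType) (X : normedModType R)
    (D : subdiff_operator X) (f : X -> \bar R) (z : X) (zs : dual X)
    (v w : X) (e : R) :
  f z \is a fin_num -> subdiff_hat D f z zs -> 0 < e ->
  exists x xs, [/\ D f x xs, ball z e x, (f x < f z + e%:E)%E,
    xs (x - z) < e & `|xs v - zs v| < e /\ `|xs w - zs w| < e].
Proof.
move=> fz [I [le [y [ys [ledir Dys yz yv ylim]]]]] e0.
have FF := tails_filter ledir.
have H1 : tails le [set i | ball z e (y i) /\ (f (y i) < f z + e%:E)%E].
  apply: (yz [set p | ball z e p.1 /\ (p.2 < f z + e%:E)%E]).
  exists (ball z e, [set r | (r < f z + e%:E)%E]); last by move=> p [].
  split; first exact: nbhsx_ballx.
  apply: open_nbhs_nbhs; split; first exact: open_ereal_lt_ereal.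
  by rewrite /= -[ltLHS]adde0 lteD2lE// lte_fin.
have H2 u : tails le [set i | `|ys i u - zs u| < e].
  have /cvgrPdist_lt/(_ _ e0) := yv u.
  by apply: filterS => i /=; rewrite distrC.
have H3 : tails le [set i | ys i (y i - z) < e].
  have /ereal_inf_lt[_ [A A0 <-] Ae] : (net_limsup le (fun i => (ys i (y i - z))%:E) < e%:E)%E.
    by apply: (le_lt_trans ylim); rewrite lte_fin.
  apply: filterS A0 => i Ai /=; rewrite -lte_fin; apply: le_lt_trans Ae.
  by apply: ereal_sup_ubound; exists i.
have [i [[[? ?] ?] [? ?]]] := filter_ex (filterI (filterI H1 H3) (filterI (H2 v) (H2 w))).
by exists (y i), (ys i).
Qed.

Definition real_convex (R : realType) (X : normedModType R) (phi : X -> R) :=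
  forall (x y : X) (t : R), 0 <= t <= 1 ->
    phi (t *: x + (1 - t) *: y) <= t * phi x + (1 - t) * phi y.

Definition real_lipschitz (R : realType) (X : normedModType R) (phi : X -> R) :=
  exists K : R, forall x y : X, phi x - phi y <= K * `|x - y|.

Lemma real_lipschitz_continuous (R : realType) (X : normedModType R)
    (phi : X -> R) : real_lipschitz phi -> continuous phi.
Proof.
move=> [K phiK] x; apply/cvgrPdist_le => e e0; apply/nbhs_ballP.
(* [K] may be zero or negative, so it cannot serve as a divisor itself. *)
have K0 : 0 < `|K| + 1 by rewrite ltr_wpDl.
exists (e / (`|K| + 1)) => /=; first by rewrite divr_gt0.
move=> y; rewrite -ball_normE /= ltr_pdivlMr// => xy.
have := phiK x y; have := phiK y x; rewrite (distrC y) => H1 H2.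
have := normr_ge0 (x - y); have := ler_norm K => K1 xy0.
by rewrite ler_norml; apply/andP; split; nra.
Qed.

Lemma real_lipschitz_lsc (R : realType) (X : normedModType R)
    (phi : X -> R) : real_lipschitz phi ->
  lower_semicontinuous (fun x => (phi x)%:E).
Proof.
move=> /real_lipschitz_continuous phic x a; rewrite lte_fin => ax.
exists [set y | a < phi y] => //.
exact: (cvgr_gt _ (phic x)).
Qed.

Lemma lscD_lipschitz (R : realType) (X : normedModType R) (f : X -> \bar R)
    (phi : X -> R) : no_ninfty f -> lower_semicontinuous f ->
  real_lipschitz phi -> lower_semicontinuous (fun x => (f x + (phi x)%:E)%E).
Proof.
move=> fN fl /real_lipschitz_continuous phic x a afx.
have [b bf ab] : exists2 b, (b%:E < f x)%E & a - b < phi x.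
  have := fN x; case: (f x) afx => [r| |] //.
    rewrite -EFinD lte_fin => ar _; exists (r - (r + phi x - a) / 2); rewrite ?lte_fin; lra.
  by move=> _ _; exists (a - phi x + 1); [rewrite ltry|lra].
have [V xV VP] := fl _ _ bf.
exists (V `&` [set y | a - b < phi y]).
  by apply: filterI => //; exact: (cvgr_gt _ (phic x)).
move=> y [/VP bfy /= aby]; apply: (@lt_le_trans _ _ (b%:E + (phi y)%:E)%E).
  by rewrite -EFinD lte_fin; lra.
by rewrite leeD2r// ltW.
Qed.

Lemma real_lipschitz_near (R : realType) (X : normedModType R)
    (phi : X -> R) (x : X) : real_lipschitz phi ->
  lipschitz_near (fun x => (phi x)%:E) x.
Proof.
move=> [K phiK]; exists setT; split => //; first exact: filterT.
apply: (@klipschitzW _ _ _ K); first exact: globally_properfilter (x, x) _.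
move=> [y z] /= _; rewrite ler_norml phiK andbT.
by have := phiK z y; rewrite distrC; lra.
Qed.

Lemma real_convexD (R : realType) (X : normedModType R) (phi psi : X -> R) :
  real_convex phi -> real_convex psi -> real_convex (fun x => phi x + psi x).
Proof.
move=> cphi cpsi x y t t01; have := cphi x y t t01; have := cpsi x y t t01; lra.
Qed.

Lemma real_lipschitzD (R : realType) (X : normedModType R) (phi psi : X -> R) :
  real_lipschitz phi -> real_lipschitz psi ->
  real_lipschitz (fun x => phi x + psi x).
Proof.
move=> [K phiK] [L psiL]; exists (K + L) => x y.
have := phiK x y; have := psiL x y; lra.
Qed.

Lemma real_convex_dist (R : realType) (X : normedModType R) (eta : R) (z : X) :
  0 <= eta -> real_convex (fun x => eta * `|x - z|).
Proof.
move=> eta0 x y t /andP[t0 t1].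
have -> : t *: x + (1 - t) *: y - z = t *: (x - z) + (1 - t) *: (y - z).
  by rewrite !scalerBr addrACA -opprD; congr (_ - _); rewrite -scalerDl addrC subrK scale1r.
have := ler_normD (t *: (x - z)) ((1 - t) *: (y - z)).
rewrite !normrZ (ger0_norm t0) (@ger0_norm _ (1 - t)) ?subr_ge0// => H.
have := ler_wpM2l eta0 H; lra.
Qed.

Lemma real_lipschitz_dist (R : realType) (X : normedModType R) (eta : R) (z : X) :
  0 <= eta -> real_lipschitz (fun x => eta * `|x - z|).
Proof.
move=> eta0; exists eta => x y; rewrite -mulrBr ler_wpM2l//.
have -> : x - y = x - z - (y - z) by rewrite opprB addrA subrK.
exact: lerB_dist.
Qed.

(* Ekeland's principle provides [z] such that [f + phi + eta `|. - z|] has a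
   local minimum at [z]; the separation principle applies there. *)
Lemma fuzzy_separation (R : realType) (X : completeNormedModType R)
    (D : subdiff_operator X) (f : X -> \bar R) (phi : X -> R) (c : X)
    (eps rho eta : R) :
  separation_principle D -> no_ninfty f -> lower_semicontinuous f ->
  edom f c -> real_convex phi -> real_lipschitz phi ->
  0 < eps -> 0 < eta -> 2 * eps / eta < rho ->
  (forall x, ball c rho x -> (f c + (phi c - eps)%:E <= f x + (phi x)%:E)%E) ->
  exists z zs ys, [/\ ball c rho z, (f z + (phi z)%:E <= f c + (phi c)%:E)%E,
    subdiff_hat D f z zs, D (fun x => (phi x + eta * `|x - z|)%:E) z ys &
    forall v : X, 0 = zs v + ys v].
Proof.
move=> sepD fN fl fc phiC phiL eps0 eta0 erho fmin.
pose F x := (f x + (phi x)%:E)%E.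
have FN : no_ninfty F by move=> x; rewrite /F lteNye// adde_eq_ninfty; have := fN x; case: (f x).
have Fl : lower_semicontinuous F by exact: lscD_lipschitz.
have fcf := edom_fin_num fN fc.
have Fc : edom F c by rewrite /edom /= /F; move: fc; rewrite /edom/=; case: (f c) => [a||] // _; rewrite -EFinD ltry.
(* The minimality of [c] up to [eps] forces [s <= eps]. With [T = 2 * eps], steps of length up to
   [eps] are still available at [z], whence the local minimum. *)
have T0 : 0 <= 2 * eps by lra.
have [z [s [/andP[s0 sT] zc gz zmax]]] := descent 0 (eta^-1) (-1) FN Fl Fc T0.
rewrite scaler0 subr0 in zc.
have czrho : ball c rho z.
  rewrite -ball_normE /= distrC; apply: le_lt_trans zc _.
  apply: le_lt_trans erho; rewrite mulrC ler_pM2r ?invr_gt0//.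
have seps : s <= eps.
  have := le_trans (fmin z czrho) gz.
  by rewrite /F -(fineK fcf) -!EFinD lee_fin; lra.
have FzFc : (F z <= F c)%E.
  by apply: (le_trans gz); rewrite geeDl// lee_fin; lra.
have fz : edom f z.
  rewrite /edom /=; move: FzFc; rewrite /F -(fineK fcf) -EFinD.
  by case: (f z) => //= a _; rewrite ltry.
pose Phi x := phi x + eta * `|x - z|.
have PhiL : real_lipschitz Phi.
  by apply: real_lipschitzD => //; apply: real_lipschitz_dist; exact: ltW.
have PhiC : real_convex Phi.
  by apply: real_convexD => //; apply: real_convex_dist; exact: ltW.
have [zs [ys [hz Dys zys]]] : exists xs ys : dual X,
      [/\ subdiff_hat D f z xs, D (fun x => (Phi x)%:E) z ys & forall v : X, 0 = xs v + ys v].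
  apply: sepD => //.
  - by move=> x; rewrite ltNyr.
  - exact: real_lipschitz_lsc.
  - exact: real_lipschitz_near.
  apply/nbhs_ballP; exists (eps / eta) => /=; first by rewrite divr_gt0.
  move=> y; rewrite -ball_normE /= distrC ltr_pdivlMr// => zy.
  have [->//|yz] := eqVneq y z.
  have yz0 : 0 < `|y - z| * eta by rewrite mulr_gt0// normr_gt0 subr_eq0.
  have H : (F z + (-1 * (`|y - z| * eta))%:E < F y)%E.
    apply: zmax => //; first by lra.
    by rewrite scaler0 subr0 mulrCA mulVf ?mulr1// gt_eqF.
  rewrite /Phi subrr normr0 mulr0 addr0; move: H; rewrite /F.
  have := fN y; have := edom_fin_num fN fz.
  case: (f z) => // a _; case: (f y) => [b _| |] //=.
    by rewrite -!EFinD lte_fin lee_fin; lra.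
  by rewrite leey.
by exists z, zs, ys.
Qed.

Lemma lsc_ball (R : realType) (X : normedModType R) (f : X -> \bar R) (c : X)
    (e : R) : f c \is a fin_num -> lower_semicontinuous f -> 0 < e ->
  exists2 rho, 0 < rho & forall x, ball c rho x -> (f c + (- e)%:E < f x)%E.
Proof.
move=> fc fl e0; rewrite -(fineK fc) -EFinD.
have [|V /nbhs_ballP[rho rho0 cV] VP] := fl c (fine (f c) - e).
  by rewrite -[ltRHS](fineK fc) lte_fin; lra.
by exists rho => // x /cV /VP.
Qed.

(** Fuzzy separation with [phi = 0] gives an element of [subdiff_hat D f z] with [z] near [y]; by
    construction such an element is approached by the graph of [D f], with convergence of the values
    of [f]. *)
Lemma subdiff_dom_dense (R : realType) (X : completeNormedModType R)
    (D : subdiff_operator X) (f : X -> \bar R) (y : X) (e : R) :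
  separation_principle D -> no_ninfty f -> lower_semicontinuous f ->
  edom f y -> 0 < e ->
  exists x, [/\ subdiff_dom D f x, ball y e x & (f x < f y + e%:E)%E].
Proof.
move=> sepD fN fl fy e0; have fyf := edom_fin_num fN fy.
have [rho rho0 frho] := lsc_ball fyf fl ltr01.
pose r := Num.min rho (e / 2).
have r0 : 0 < r by rewrite lt_min rho0 divr_gt0.
(* Makes the radius [2 / eta] equal to [r / 2]. *)
pose eta := 4 / r.
have eta0 : 0 < eta by rewrite divr_gt0.
have etar : 2 * 1 / eta < r.
  by rewrite /eta invf_div mulr1 mulrA ltr_pdivrMr//; lra.
have [||x yx|z [zs [ys [yz fzy hz _ _]]]] :=
  @fuzzy_separation R X D f (fun=> 0) y 1 r eta sepD fN fl fy _ _ ltr01 eta0 etar.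
- by move=> ? ? ? _; rewrite !mulr0 addr0.
- by exists 0 => ? ?; rewrite subrr mul0r.
- rewrite sub0r adde0; apply/ltW/frho.
  by apply: le_ball yx; rewrite ge_min lexx.
rewrite !adde0 in fzy.
have fz : f z \is a fin_num by apply: edom_fin_num => //; exact: le_lt_trans fy.
have e2 : 0 < e / 2 by rewrite divr_gt0.
have [x [xs [Dx zx fx _ _]]] := subdiff_hat_approx 0 0 fz hz e2.
exists x; split; first by exists xs.
  rewrite [e]splitr; apply: ball_triangle zx.
  by apply: le_ball yz; rewrite ge_min lexx orbT.
apply: (lt_le_trans fx); apply: leeD => //; rewrite lee_fin; lra.
Qed.

(** * Lower semicontinuity and compactness *)

Lemma lte_real_between (R : realType) (x y : \bar R) :
  (x < y)%E -> exists r : R, (x < r%:E)%E /\ (r%:E < y)%E.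
Proof.
case: x y => [x| |] [y| |] //.
- by rewrite lte_fin => xy; exists ((x + y) / 2); rewrite !lte_fin; lra.
- by move=> _; exists (x + 1); rewrite lte_fin ltry; split => //; lra.
- by move=> _; exists (y - 1); rewrite lte_fin ltNyr; split => //; lra.
- by move=> _; exists 0; rewrite ltry ltNyr.
Qed.

(** Were the infimum [m] not attained, each point would have a neighbourhood where [h] exceeds some
    real above [m]. Compactness, applied with the filter [F] of reals decreasing to [m], makes this
    real uniform, which contradicts the choice of [m]. *)
Lemma lsc_compact_min (R : realType) (T : topologicalType) (h : T -> \bar R)
    (K : set T) : lower_semicontinuous h -> compact K -> K !=set0 ->
  exists2 s, K s & forall s', K s' -> (h s <= h s')%E.
Proof.
move=> hl /compact_near_coveringP Kc [k Kk]; apply: contrapT => H.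
pose m := ereal_inf (h @` K).
have mh s : K s -> (m < h s)%E.
  move=> Ks; rewrite ltNge; apply/negP => hm; apply: H; exists s => // s' Ks'.
  by apply: (le_trans hm); apply: ereal_inf_lbound; exists s'.
pose F := filter_from [set r : R | (m < r%:E)%E]
  (fun r => [set r' | (m < r'%:E)%E /\ r' <= r]).
have FF : Filter F.
  apply: filter_from_filter.
    by have [r []] := lte_real_between (mh k Kk); exists r.
  move=> i j /= mi mj; exists (Num.min i j) => /=; first by rewrite minEle; case: ifP.
  by move=> r [mr]; rewrite le_min => /andP[].
have [|r mr] := Kc _ F (fun r s => (r%:E < h s)%E) FF.
  move=> s Ks; have [r [mr rh]] := lte_real_between (mh s Ks).
  have [V sV VP] := hl s r rh.
  exists (V, [set r' | (m < r'%:E)%E /\ r' <= r]).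
    by split => //; exists r.
  by move=> [s' r'] /= [/VP rs' [_ r'r]]; apply: le_lt_trans rs'; rewrite lee_fin.
move=> /(_ r) /= Hr; have := Hr (conj mr (lexx _)) => KP.
have : (r%:E <= m)%E by apply: le_ereal_inf_tmp => _ [s Ks <-]; exact/ltW/KP.
by rewrite leNgt mr.
Qed.

(** Tube argument: each point of the segment has a neighbourhood on which the relaxed bound holds,
    and compactness of the parameter interval gives a common radius. *)
Lemma lsc_segment_nbhd (R : realType) (X : normedModType R) (f : X -> \bar R)
    (a u : X) (lam T m e : R) : lower_semicontinuous f -> 0 < e ->
  (forall s, 0 <= s <= T -> ((m + lam * s)%:E <= f (a + s *: u)%R)%E) ->
  exists2 delta, 0 < delta & forall s x, 0 <= s <= T ->
    `|x - a - s *: u| < delta -> ((m + lam * s - e)%:E < f x)%E.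
Proof.
move=> fl e0 fm.
have /compact_near_coveringP Kc := @segment_compact R 0 T.
suff cover s : `[0, T]%classic s -> \forall s' \near s & y \near (0 : X),
    ((m + lam * s' - e)%:E < f (a + s' *: u + y)%R)%E.
  have H : nbhs (0 : X) [set y : X | forall s, `[0, T]%classic s ->
      ((m + lam * s - e)%:E < f (a + s *: u + y)%R)%E].
    exact: (Kc X (nbhs (0 : X))
      (fun y s => ((m + lam * s - e)%:E < f (a + s *: u + y)%R)%E) _ cover).
  have [d d0 dP] := (nbhs_ballP _ _).1 H.
  exists d => // s x sT xs.
  have := dP (x - a - s *: u); rewrite -ball_normE /= sub0r normrN => /(_ xs s).
  rewrite (_ : a + s *: u + _ = x); last first.
    by rewrite -(addrA x) -opprD (addrC _ (x - _)) subrK.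
  by apply; rewrite /= in_itv.
rewrite /= in_itv /= => sT.
have ms : ((m + lam * s - e / 2)%:E < f (a + s *: u)%R)%E.
  by apply: lt_le_trans (fm s sT); rewrite lte_fin; lra.
have [V sV VP] := fl _ _ ms.
have c1 : \forall s' \near s & y \near (0 : X), V (a + s' *: u + y).
  have : (fun p : R * X => a + p.1 *: u + p.2) @ (s, 0 : X) --> a + s *: u + 0.
    apply: cvgD; last exact: cvg_snd.
    apply: cvgD; first exact: cvg_cst.
    by apply: cvgZr_tmp; exact: cvg_fst.
  by rewrite addr0 => /(_ V sV).
have c2 : \forall s' \near s & y \near (0 : X), lam * s' - e / 2 < lam * s.
  have : (fun p : R * X => lam * p.1 - e / 2) @ (s, 0 : X) --> lam * s - e / 2.
    apply: cvgB; last exact: cvg_cst.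
    by apply: cvgMr; exact: cvg_fst.
  by move=> /cvgr_lt; apply; lra.
near=> p; apply: (@le_lt_trans _ _ (m + lam * s - e / 2)%:E).
  have : lam * p.1 - e / 2 < lam * s by near: p.
  by rewrite lee_fin; lra.
apply: VP; near: p; exact: c1.
Unshelve. all: by end_near. Qed.

(* Infimal convolution of [K `|.|] with the function equal to [- lam s] at
   [a + s u], [s >= 0]: it penalizes the distance to the ray and, at the same
   time, replaces a linear functional taking the value [- lam] at [u]. *)
Definition ray_penalty (R : realType) (X : normedModType R) (K lam : R)
    (a u x : X) : R :=
  inf [set K * `|x - a - s *: u| - lam * s | s in [set s | 0 <= s]].

(** * The ray penalty and a mean value inequality *)

Section RayPenalty.
Context (R : realType) (X : normedModType R) (K lam : R) (a u : X).
Hypotheses (u0 : u != 0) (K1 : `|lam| / `|u| <= K).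
Let phi := ray_penalty K lam a u.

(** Triangle inequality through [x] between the points of parameters [s0] and [s] on the line; the
    factor [|lam| / |u|] turns their distance into [|lam * (s - s0)|]. Hence the set defining
    [ray_penalty] is bounded below and its [inf] is a genuine infimum. *)
Lemma ray_dist_lb (s0 s : R) (x : X) :
  - (lam * s0) - `|lam| / `|u| * `|x - (a + s0 *: u)| <=
    `|lam| / `|u| * `|x - a - s *: u| - lam * s.
Proof.
have un : 0 < `|u| by rewrite normr_gt0.
have k0 : 0 <= `|lam| / `|u| by rewrite divr_ge0.
have : `|(s - s0) *: u| <= `|x - (a + s0 *: u)| + `|x - a - s *: u|.
  have -> : (s - s0) *: u = (x - (a + s0 *: u)) - (x - a - s *: u).
    have -> : x - a - s *: u = x - (a + s *: u) by rewrite opprD addrA.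
    rewrite opprB (addrC (x - _)) addrA subrK opprD addrACA.
    by rewrite subrr add0r scalerBl.
  exact: ler_normB.
rewrite normrZ => /(ler_wpM2l k0).
have -> : `|lam| / `|u| * (`|s - s0| * `|u|) = `|lam * (s - s0)|.
  by rewrite normrM; field; rewrite gt_eqF.
have := ler_norm (lam * (s - s0)); lra.
Qed.

Let KI0 : 0 <= K.
Proof. by apply: le_trans K1; rewrite divr_ge0. Qed.

Lemma ray_penalty_lb (s0 : R) (x : X) :
  - (lam * s0) - `|lam| / `|u| * `|x - (a + s0 *: u)| <= phi x.
Proof.
apply: lb_le_inf; first by exists (K * `|x - a - 0 *: u| - lam * 0), 0 => //=.
move=> _ [s /= _ <-]; apply: le_trans (ray_dist_lb s0 s x) _.
by rewrite lerD2r ler_wpM2r.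
Qed.

Lemma ray_penalty_ub (s : R) (x : X) : 0 <= s ->
  phi x <= K * `|x - a - s *: u| - lam * s.
Proof.
move=> s0; apply: ge_inf; last by exists s.
exists (- (lam * 0) - `|lam| / `|u| * `|x - (a + 0 *: u)|) => _ [r /= _ <-].
by apply: le_trans (ray_dist_lb 0 r x) _; rewrite lerD2r ler_wpM2r.
Qed.

Lemma ray_penalty_approx (x : X) (e : R) : 0 < e ->
  exists2 s, 0 <= s & K * `|x - a - s *: u| - lam * s < phi x + e.
Proof.
move=> e0; have [|_ [s /= s0 <-] ?] := @inf_adherent R
  [set K * `|x - a - s *: u| - lam * s | s in [set s | 0 <= s]] _ e0.
  split; first by exists (K * `|x - a - 0 *: u| - lam * 0), 0 => //=.
  exists (- (lam * 0) - `|lam| / `|u| * `|x - (a + 0 *: u)|) => _ [r /= _ <-].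
  by apply: le_trans (ray_dist_lb 0 r x) _; rewrite lerD2r ler_wpM2r.
by exists s.
Qed.

Lemma ray_penalty_lipschitz : real_lipschitz phi.
Proof.
exists K => x y; apply/ler_addgt0Pr => e e0.
have [s s0 sy] := ray_penalty_approx y e0.
have := ray_penalty_ub x s0.
have : `|x - a - s *: u| <= `|x - y| + `|y - a - s *: u|.
  have -> : x - a - s *: u = (x - y) + (y - a - s *: u) by rewrite addrA addrA subrK.
  exact: ler_normD.
move/(ler_wpM2l KI0); lra.
Qed.

(** The function under the infimum is jointly convex in [x] and [s], and partial minimization over
    the half-line [s >= 0] preserves convexity. *)
Lemma ray_penalty_convex : real_convex phi.
Proof.
move=> x y t /andP[t0 t1]; apply/ler_addgt0Pr => e e0.
have [r r0 rx] := ray_penalty_approx x e0.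
have [s s0 sy] := ray_penalty_approx y e0.
have rs0 : 0 <= t * r + (1 - t) * s by rewrite addr_ge0// mulr_ge0// subr_ge0.
have := ray_penalty_ub (t *: x + (1 - t) *: y) rs0.
have -> : t *: x + (1 - t) *: y - a - (t * r + (1 - t) * s) *: u =
    t *: (x - a - r *: u) + (1 - t) *: (y - a - s *: u).
  rewrite !scalerBr (scalerDl u) -!scalerA opprD [RHS]addrACA; congr (_ + _).
  rewrite addrACA -opprD; congr (_ - _).
  by rewrite -scalerDl addrC subrK scale1r.
have := ler_normD (t *: (x - a - r *: u)) ((1 - t) *: (y - a - s *: u)).
rewrite !normrZ (ger0_norm t0) (@ger0_norm _ (1 - t)) ?subr_ge0//.
move=> /(ler_wpM2l KI0) H1 H2.
have t1' : 0 <= 1 - t by lra.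
have := ler_wpM2l t0 (ltW rx); have := ler_wpM2l t1' (ltW sy); lra.
Qed.

(** Moving [x] and the point of the ray together by [t *: u] leaves their distance unchanged. This
    is how [phi] imitates a functional with value [- lam] at [u]. *)
Lemma ray_penalty_shift (x : X) (t : R) : 0 <= t ->
  phi (x + t *: u) <= phi x - lam * t.
Proof.
move=> t0; apply/ler_addgt0Pr => e e0.
have [s s0 sx] := ray_penalty_approx x e0.
have := ray_penalty_ub (x + t *: u) (addr_ge0 s0 t0).
have -> : x + t *: u - a - (s + t) *: u = x - a - s *: u.
  by rewrite scalerDl opprD addrA addrAC; congr (_ - _); rewrite addrAC addrK.
lra.
Qed.

End RayPenalty.

(** By [upsubder_le_radsubder], a value of [ys (v z)] above [r] would show up as a radial
    subderivative above [r] along [v] at some point near [z], where the growth hypothesis excludes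
    it. *)
Lemma subdiff_C_le (R : realType) (X : completeNormedModType R) (Phi : X -> R)
    (z : X) (ys : dual X) (v : X -> X) (r rho : R) :
  real_lipschitz Phi -> subdiff_C (fun x => (Phi x)%:E) z ys ->
  {for z, continuous v} -> 0 < rho ->
  (forall x t, ball z rho x -> 0 < t < 1 ->
     Phi (x + t *: v x) <= Phi x + r * t) -> ys (v z) <= r.
Proof.
move=> PhiL [_ ysv] vz rho0 Phir; rewrite leNgt; apply/negP => rys.
have [r' [rr' r'ys]] : exists r', r < r' /\ r' < ys (v z).
  by exists ((r + ys (v z)) / 2); lra.
have PN : no_ninfty (fun x => (Phi x)%:E) by move=> x; rewrite ltNyr.
have Pz : edom (fun x => (Phi x)%:E) z by rewrite /edom /= ltry.
have up : (r'%:E < upsubder (fun x => (Phi x)%:E) z (v z))%E.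
  by apply: lt_le_trans (ysv _); rewrite lte_fin.
have [x [zx _]] := upsubder_le_radsubder PN (real_lipschitz_lsc PhiL) Pz vz rho0 up.
rewrite leNgt => /negP; apply; rewrite ltNge; apply/negP => r'x.
have : (r%:E < radsubder (fun x => (Phi x)%:E) x (v x))%E.
  by apply: lt_le_trans r'x; rewrite lte_fin.
move=> /limf_einf_right_gt[e e0 /(_ (Num.min e 1 / 2))].
have m0 : 0 < Num.min e 1 by rewrite lt_min e0 ltr01.
have me : Num.min e 1 <= e by rewrite ge_min lexx.
have m1 : Num.min e 1 <= 1 by rewrite ge_min lexx orbT.
have t0 : 0 < Num.min e 1 / 2 by lra.
have te : 0 < Num.min e 1 / 2 < e by apply/andP; split => //; lra.
move=> /(_ te); rewrite ltNge diffquot_le// -EFinD lee_fin Phir//.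
by apply/andP; split => //; lra.
Qed.

(** On the segment [f] stays above an affine function that it touches at [c], so [f + phi] is almost
    minimal at [c], and fuzzy separation gives [zs = - ys] with [ys] a Clarke subgradient of [Phi].
    Testing [ys] along [u] and towards [c] gives the two estimates. As the ray has no points with
    [s < 0], the contact may be at [s0 = 0]. *)
Lemma subdiff_mean_value (R : realType) (X : completeNormedModType R)
    (D : subdiff_operator X) (f : X -> \bar R) (a u : X) (lam T m s0 e : R) :
  is_subdifferential D -> no_ninfty f -> lower_semicontinuous f ->
  u != 0 -> 0 <= s0 < T ->
  (forall s, 0 <= s <= T -> ((m + lam * s)%:E <= f (a + s *: u)%R)%E) ->
  f (a + s0 *: u) = (m + lam * s0)%:E -> 0 < e ->
  exists x xs, [/\ D f x xs, ball (a + s0 *: u) e x,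
    - e < xs (a + s0 *: u - x) & lam - e < xs u].
Proof.
move=> [Dsub sepD] fN fl u0 /andP[s00 s0T] fm fc e0.
set c := a + s0 *: u.
have fcf : f c \is a fin_num by rewrite fc.
have cdom : edom f c by rewrite /edom /= fc ltry.
have un : 0 < `|u| by rewrite normr_gt0.
pose K1 := `|lam| / `|u|.
have K10 : 0 <= K1 by rewrite divr_ge0.
pose eta := e / (4 * (`|u| + 1)).
have eta0 : 0 < eta by rewrite divr_gt0// mulr_gt0//; lra.
have etau : eta * `|u| < e / 4.
  by rewrite /eta mulrAC ltr_pdivrMr ?mulr_gt0//; nra.
have [rho1 rho10 frho1] := lsc_ball fcf fl ltr01.
(* Half the distance from [c] to the end of the segment: a ray point within [delta <= r2] of a point
   of [ball c rho] then has parameter at most [T]. *)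
pose r2 := (T - s0) * `|u| / 2.
have r20 : 0 < r2 by rewrite divr_gt0// mulr_gt0// subr_gt0.
pose r3 := e / (4 * (K1 + eta + 1)).
have r30 : 0 < r3 by rewrite divr_gt0// mulr_gt0//; lra.
pose rho := Num.min (Num.min rho1 r2) (Num.min (e / 2) r3).
have rho0 : 0 < rho by rewrite !lt_min rho10 r20 r30 divr_gt0.
have [rho_1 [rho_2 [rho_e rho_3]]] : rho <= rho1 /\ rho <= r2 /\ rho <= e / 2 /\ rho <= r3.
  by rewrite /rho !ge_min !lexx ?orbT.
have Krho : (K1 + eta) * rho < e / 4.
  apply: (@le_lt_trans _ _ ((K1 + eta) * r3)); first by rewrite ler_wpM2l// addr_ge0// ltW.
  rewrite /r3 mulrA ltr_pdivrMr ?mulr_gt0//; last by lra.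
  by nra.
pose eps := eta * rho / 4.
have eps0 : 0 < eps by rewrite divr_gt0// mulr_gt0.
have epsrho : 2 * eps / eta < rho.
  by rewrite ltr_pdivrMr// /eps; nra.
have [delta1 delta10 fdelta1] := lsc_segment_nbhd fl eps0 fm.
pose delta := Num.min delta1 r2.
have delta0 : 0 < delta by rewrite lt_min delta10.
have [delta_1 delta_2] : delta <= delta1 /\ delta <= r2.
  by rewrite /delta !ge_min !lexx ?orbT.
(* Outside the tube of radius [delta], the penalty [L * delta] compensates for the crude bound
   [f c - 1 < f x] and for the slope term [K1 * rho]. *)
pose L := (1 + K1 * rho) / delta.
have L0 : 0 <= L by rewrite divr_ge0 ?(ltW delta0)// addr_ge0// mulr_ge0// ltW.
have Ldelta : L * delta = 1 + K1 * rho by rewrite /L divfK// gt_eqF.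
pose K := K1 + L.
have K1K : `|lam| / `|u| <= K by rewrite -/K1 /K; lra.
pose phi := ray_penalty K lam a u.
have phic : phi c <= - (lam * s0).
  have := ray_penalty_ub a u0 K1K c s00.
  by rewrite /c (addrC a) addrK subrr normr0 mulr0 sub0r.
(* The slope here is [K1], not [K]: since [K] depends on [delta], itself chosen after [rho], the
   product [K * rho] could not be made small. *)
have philb x : - (lam * s0) - K1 * `|x - c| <= phi x.
  exact: (ray_penalty_lb a u0 K1K).
have phiL : real_lipschitz phi := ray_penalty_lipschitz a u0 K1K.
have phiC : real_convex phi := ray_penalty_convex a u0 K1K.
have fphi x : ball c rho x -> (f c + (phi c - eps)%:E <= f x + (phi x)%:E)%E.
  move=> cx; rewrite fc -EFinD.
  have fx1 := frho1 x (le_ball rho_1 cx).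
  have := fN x; case E : (f x) => [y| |] // _; last by rewrite addye// leey.
  rewrite E fc -EFinD lte_fin in fx1.
  rewrite -EFinD lee_fin -lerBlDl.
  suff H : m - eps - y <= phi x by apply: le_trans H; lra.
  move: cx; rewrite -ball_normE /= distrC => cx.
  apply: lb_le_inf; first by exists (K * `|x - a - 0 *: u| - lam * 0), 0 => //=.
  move=> _ [s /= s_ge0 <-].
  have lb := @ray_dist_lb R X lam a u u0 s0 s x.
  have [xd|xd] := ltP `|x - a - s *: u| delta.
    have sT : s <= T.
      have : `|(s - s0) *: u| <= `|x - c| + `|x - a - s *: u|.
        have -> : (s - s0) *: u = x - c - (x - a - s *: u).
          have -> : x - a - s *: u = x - (a + s *: u) by rewrite opprD addrA.
          rewrite opprB (addrC (x - _)) addrA subrK opprD addrACA.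
          by rewrite subrr add0r scalerBl.
        exact: ler_normB.
      rewrite normrZ => H.
      have : (s - s0) * `|u| <= (T - s0) * `|u|.
        apply: le_trans (ler_wpM2r (ltW un) (ler_norm _)) _.
        by apply: (le_trans H); rewrite /r2 in rho_2 delta_2; lra.
      by rewrite ler_pM2r//; lra.
    have sT' : 0 <= s <= T by rewrite s_ge0.
    have := fdelta1 s x sT' (lt_le_trans xd delta_1).
    rewrite E lte_fin => H.
    have : 0 <= K * `|x - a - s *: u| by rewrite mulr_ge0// /K addr_ge0.
    lra.
  have H1 : L * delta <= L * `|x - a - s *: u| by rewrite ler_wpM2l.
  have H2 : K1 * `|x - c| <= K1 * rho by rewrite ler_wpM2l// ltW.
  rewrite -/K1 -/c in lb; rewrite /K mulrDl; lra.
have [z [zs [ys [cz fzc hz Dys zsys]]]] :=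
  fuzzy_separation sepD fN fl cdom phiC phiL eps0 eta0 epsrho fphi.
pose Phi x := phi x + eta * `|x - z|.
have PhiL : real_lipschitz Phi.
  by apply: real_lipschitzD => //; apply: real_lipschitz_dist; exact: ltW.
have PhiC : real_convex Phi.
  by apply: real_convexD => //; apply: real_convex_dist; exact: ltW.
have Phip : proper_lsc (fun x => (Phi x)%:E).
  split; first by move=> x; rewrite ltNyr.
    by exists z; rewrite /edom /= ltry.
  exact: real_lipschitz_lsc.
have ysC : subdiff_C (fun x => (Phi x)%:E) z ys := (Dsub _ Phip z).2 _ Dys.
have cz' : `|z - c| < rho by move: cz; rewrite -ball_normE /= distrC.
have ysu : ys u <= - lam + eta * `|u|.
  apply: (subdiff_C_le (v := fun=> u) PhiL ysC (cvg_cst _) ltr01).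
  move=> x t _ /andP[t0 _].
  have := ray_penalty_shift a u0 K1K x (ltW t0); rewrite -/phi => H1.
  have : `|x + t *: u - z| <= `|x - z| + t * `|u|.
    by rewrite addrAC -{2}(gtr0_norm t0) -normrZ ler_normD.
  by rewrite /Phi => /(ler_wpM2l (ltW eta0)); lra.
(* Along the field [c - x], convexity of [Phi] reduces the growth to [Phi c - Phi x], which [philb]
   controls. *)
have ysc : ys (c - z) <= (K1 + eta) * rho.
  have rz : 0 < rho - `|z - c| by rewrite subr_gt0.
  apply: (subdiff_C_le (v := fun x => c - x) PhiL ysC _ rz).
    by apply: cvgB; [exact: cvg_cst|exact: cvg_id].
  move=> x t zx /andP[t0 t1].
  have xc : `|x - c| <= rho.
    move: zx; rewrite -ball_normE /= => zx.
    have -> : x - c = (z - c) - (z - x) by rewrite opprB [RHS]addrC addrA subrK.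
    by apply: le_trans (ler_normB _ _) _; lra.
  have -> : x + t *: (c - x) = t *: c + (1 - t) *: x.
    by rewrite scalerBr scalerBl scale1r addrCA.
  have t01 : 0 <= t <= 1 by rewrite !ltW.
  apply: le_trans (PhiC c x t t01) _.
  have : `|c - z| <= `|x - z| + `|x - c|.
    have -> : c - z = (x - z) - (x - c) by rewrite opprB [RHS]addrC addrA subrK.
    exact: ler_normB.
  move=> /(ler_wpM2l (ltW eta0)) H1.
  have H2 := philb x.
  have H3 : K1 * `|x - c| <= K1 * rho by rewrite ler_wpM2l.
  have H4 : eta * `|x - c| <= eta * rho by rewrite ler_wpM2l// ltW.
  have : Phi c - Phi x <= (K1 + eta) * rho by rewrite /Phi; lra.
  move=> /(ler_wpM2l (ltW t0)); lra.
have fz : f z \is a fin_num.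
  apply: edom_fin_num => //; move: fzc; rewrite /edom /= fc -EFinD.
  by case: (f z) => //= r _; rewrite ltry.
have e4 : 0 < e / 4 by rewrite divr_gt0.
(* The second test vector is [c - z]: with the bound on [xs (x - z)] it controls [xs (c - x)],
   although [x] varies with the net. *)
have [x [xs [Dx zx _ xz [xu xc]]]] := subdiff_hat_approx u (c - z) fz hz e4.
have zu := zsys u; have zc := zsys (c - z).
exists x, xs; split => //.
- have -> : e = e / 2 + e / 2 by lra.
  apply: (ball_triangle (y := z)); first exact: le_ball cz.
  by apply: le_ball zx; lra.
- have -> : c - x = (c - z) - (x - z) by rewrite opprB addrA subrK.
  rewrite linearB /=; move: xc; rewrite ltr_norml => /andP[? ?].
  lra.
- move: xu; rewrite ltr_norml => /andP[? ?]; lra.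
Qed.

(** * Comparison of the radial subderivatives of [f] and [g] *)

(** With [e = 1 / (n + 1)] the points form a sequence whose directions absorb the whole error, being
    within [1 / (n + 1)] of [v]. The case [v = 0] serves strict semismoothness. *)
Lemma dir_limsup_ge (R : realType) (X : normedModType R) (g F : X -> \bar R)
    (v xbar : X) (lam : R) :
  (forall e : R, 0 < e -> exists t x, [/\ 0 < t < e,
     `|x - xbar - t *: v| <= e * t, edom g x & ((lam - e)%:E <= F x)%E]) ->
  (lam%:E <= dir_limsup g v xbar F)%E.
Proof.
move=> H.
have /choice[p pP] (n : nat) : exists p : R * X, [/\ 0 < p.1 < n.+1%:R^-1,
    `|p.2 - xbar - p.1 *: v| <= n.+1%:R^-1 * p.1, edom g p.2 &
    ((lam - n.+1%:R^-1)%:E <= F p.2)%E].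
  have n0 : 0 < n.+1%:R^-1 :> R by rewrite invr_gt0.
  by have [t [x ?]] := H _ n0; exists (t, x).
have inv0 (e : R) : 0 < e -> \forall n \near \oo, n.+1%:R^-1 < e.
  by move=> e0; exact: (near_infty_natSinv_lt (PosNum e0)).
apply: (@le_trans _ _ (limn_esup (F \o (fun n => (p n).2)))); last first.
  apply: ereal_sup_ubound; exists (fun n => (p n).2) => //; split; last first.
    by move=> n; have [] := pP n.
  exists (fun n => (p n).1), (fun n => v + (p n).1^-1 *: ((p n).2 - xbar - (p n).1 *: v)).
  split.
  - by move=> n; have [/andP[]] := pP n.
  - apply/cvgrPdist_lt => e e0; near=> n.
    have [/andP[p0 pn] _ _ _] := pP n; rewrite sub0r normrN gtr0_norm//.
    by apply: lt_trans pn _; near: n; exact: inv0.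
  - apply/cvgrPdist_lt => e e0; near=> n.
    have [/andP[p0 _] pn _ _] := pP n.
    rewrite opprD addrA subrr add0r normrN normrZ gtr0_norm ?invr_gt0//.
    rewrite mulrC ltr_pdivrMr//; apply: (le_lt_trans pn); rewrite ltr_pM2r//.
    by near: n; exact: inv0.
  - move=> n; have [/andP[p0 _] _ _ _] := pP n.
    by rewrite scalerDr scalerA mulfV ?gt_eqF// scale1r (addrC (_ *: v)) subrK addrCA subrr addr0.
apply: le_ereal_inf_tmp => _ [A Aoo <-].
apply/lee_addgt0Pr => e e0; rewrite -leeBlDr//.
have [n [An ne]] := filter_ex (filterI Aoo (inv0 e e0)).
apply: (@le_trans _ _ (F (p n).2)); last by apply: ereal_sup_ubound; exists n.
have [_ _ _] := pP n; apply: le_trans; rewrite -EFinB lee_fin.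
by rewrite lerD2l lerN2 ltW.
Unshelve. all: by end_near. Qed.

Section SubdifferentialInclusion.
Context (R : realType) (X : completeNormedModType R) (D : subdiff_operator X)
  (Omega : set X) (f g : X -> \bar R).
Hypotheses (hD : is_subdifferential D) (hO : open Omega)
  (hf : proper_lsc f) (hg : proper_lsc g)
  (hfg : forall x : X, (Omega `&` edom f) x -> D f x `<=` D g x).

(* The direction [u + alpha *: (xbar - x)] at [x = xbar + s *: u] is
   [(1 - alpha * s) *: u], whence the factor of [lam]. *)
Lemma radsubder_transfer (xbar u : X) (alpha s lam : R) :
  0 <= alpha -> 0 <= s -> alpha * s <= 1 -> Omega (xbar + s *: u) ->
  (forall e : R, 0 < e -> exists x xs, [/\ D f x xs, ball (xbar + s *: u) e x,
     - e < xs (xbar + s *: u - x) & lam - e < xs u]) ->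
  forall e : R, 0 < e -> exists x, [/\ ball (xbar + s *: u) e x, edom g x &
    (((1 - alpha * s) * lam - e)%:E
       <= radsubder g x (u + alpha *: (xbar - x))%R)%E].
Proof.
set c := xbar + s *: u.
move=> alpha0 s0 as1 Oc H e e0.
have [r r0 cO] : exists2 r, 0 < r & forall x, ball c r x -> Omega x.
  by have /nbhs_ballP[r r0 cO] := open_nbhs_nbhs (conj hO Oc); exists r.
(* The errors on [xs u] and on [alpha * xs (c - x)] add up to at most [(1 + alpha) * e1 = e / 2]. *)
pose e1 := e / (2 * (1 + alpha)).
have e10 : 0 < e1 by rewrite divr_gt0// mulr_gt0//; lra.
have e1e : e1 * (1 + alpha) = e / 2.
  rewrite /e1; field; apply/eqP; lra.
have e1e2 : e1 <= e / 2 by rewrite -e1e; nra.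
have m0 : 0 < Num.min e1 r by rewrite lt_min e10.
have [m1 mr] : Num.min e1 r <= e1 /\ Num.min e1 r <= r.
  by rewrite !ge_min !lexx ?orbT.
have [x [xs [Dx cx xc xu]]] := H _ m0.
have Ox : Omega x by apply: cO; exact: le_ball cx.
have fx : edom f x by have [] := (hD.1 f hf x).2 _ Dx.
(* The inclusion of subdifferentials enters here: [xs] becomes a Clarke subgradient of [g]. *)
have [gx xsg] := (hD.1 g hg x).2 _ (hfg (conj Ox fx) Dx).
pose v y := u + alpha *: (xbar - y).
have vx : {for x, continuous v}.
  apply: cvgD; first exact: cvg_cst.
  by apply: cvgZl_tmp; apply: cvgB; [exact: cvg_cst|exact: cvg_id].
have xsv : (1 - alpha * s) * lam - e < xs (v x).
  have -> : v x = (1 - alpha * s) *: u + alpha *: (c - x).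
    rewrite /v /c scalerBl scale1r -addrA; congr (_ + _).
    rewrite -scalerA [RHS]addrC -scalerBr; congr (_ *: _).
    by rewrite [RHS]addrAC addrK.
  rewrite linearD !linearZ /=.
  have as0 : 0 <= alpha * s by rewrite mulr_ge0.
  have : (1 - alpha * s) * (lam - e1) <= (1 - alpha * s) * xs u.
    by rewrite ler_wpM2l//; lra.
  have : alpha * - e1 <= alpha * xs (c - x) by rewrite ler_wpM2l//; lra.
  have : 0 <= alpha * s * e1 by rewrite mulr_ge0// ltW.
  by rewrite /GRing.scale /=; lra.
have e20 : 0 < e / 2 by rewrite divr_gt0.
have [gN _ gl] := hg.
have [|x' [xx' gx' rx']] := upsubder_le_radsubder gN gl gx vx e20 (r := (1 - alpha * s) * lam - e).
  by apply: lt_le_trans (xsg _); rewrite lte_fin.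
exists x'; split => //; rewrite [e]splitr; apply: ball_triangle xx'.
by apply: le_ball cx; lra.
Qed.

(** For [lam] below the radial subderivative of [f], the affine function of slope [lam] touches [f]
    at [xbar] itself. The mean value inequality at [s0 = 0] gives points near [xbar] with no
    preferred direction, hence the strict form of semismoothness. *)
Lemma radsubder_le_strict (xbar u : X) :
  u != 0 -> Omega xbar -> edom f xbar -> strictly_upper_semismooth g xbar u ->
  (radsubder f xbar u <= radsubder g xbar u)%E.
Proof.
move=> u0 Ox fx [gx gsm]; have [fN _ fl] := hf.
have fxf := edom_fin_num fN fx.
rewrite leNgt; apply/negP => /lte_real_between[lam [glam lamf]].
have : (lam%:E <= radsubder g xbar u)%E; last by rewrite leNgt glam.
apply: le_trans gsm; apply: le_ereal_inf_tmp => _ [alpha /= alpha0 <-].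
apply: dir_limsup_ge => e e0.
have [d d0 fd] := limf_einf_right_gt lamf.
have d2 : 0 < d / 2 by rewrite divr_gt0.
have mv := @subdiff_mean_value R X D f xbar u lam (d / 2) (fine (f xbar)) 0 _ hD fN fl u0.
have H e' : 0 < e' -> exists x xs, [/\ D f x xs, ball (xbar + 0 *: u) e' x,
     - e' < xs (xbar + 0 *: u - x) & lam - e' < xs u].
  move=> e'0; apply: mv => //.
  - by rewrite lexx d2.
  - move=> s /andP[s0 sd]; rewrite EFinD fineK//.
    have [->|sn] := eqVneq s 0; first by rewrite mulr0 adde0 scale0r addr0.
    have s0' : 0 < s by rewrite lt_neqAle eq_sym sn.
    rewrite leNgt -diffquot_lt// -leNgt; apply/ltW/fd.
    by rewrite s0' /=; lra.
  - by rewrite mulr0 addr0 scale0r addr0 fineK.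
(* With [t = e / 2], convergence in the direction 0 requires a distance at most [e * t]. *)
have e2 : 0 < Num.min (e * (e / 2)) e by rewrite lt_min e0 mulr_gt0// divr_gt0.
have [||x [xx gx' rx]] := @radsubder_transfer xbar u alpha 0 lam alpha0 (lexx _) _ _ H _ e2.
- by rewrite mulr0.
- by rewrite scale0r addr0.
rewrite scale0r addr0 -ball_normE /= lt_min distrC in xx.
have /andP[xx1 xx2] := xx.
exists (e / 2), x; split => //.
- by apply/andP; split; lra.
- by rewrite scaler0 subr0 ltW.
- apply: le_trans rx; rewrite lee_fin mulr0 subr0 mul1r lerD2l lerN2.
  by rewrite ge_min lexx orbT.
Qed.

(** Accessibility gives small [s1 > 0] with [f (xbar + s1 *: u)] close to [f xbar]. Then
    [f - lam * s] has a minimum over [[s1, T]] at some [s0 < T], and [s0 > 0] places the mean value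
    points in the direction [u] from [xbar]. *)
Lemma radsubder_le_accessible (xbar u : X) :
  u != 0 -> Omega xbar -> radially_accessible f xbar u ->
  upper_semismooth g xbar u ->
  (radsubder f xbar u <= radsubder g xbar u)%E.
Proof.
move=> u0 Ox [fx facc] [gx gsm]; have [fN _ fl] := hf.
have fxf := edom_fin_num fN fx.
rewrite leNgt; apply/negP => /lte_real_between[lam [glam /lte_real_between[lam' [ll lamf]]]].
rewrite lte_fin in ll.
have : (lam%:E <= radsubder g xbar u)%E; last by rewrite leNgt glam.
apply: le_trans gsm; apply: le_ereal_inf_tmp => _ [alpha /= alpha0 <-].
apply: dir_limsup_ge => e e0.
have [d d0 fd] := limf_einf_right_gt lamf.
have [r r0 xO] : exists2 r, 0 < r & forall x, ball xbar r x -> Omega x.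
  by have /nbhs_ballP[r r0 cO] := open_nbhs_nbhs (conj hO Ox); exists r.
have un : 0 < `|u| by rewrite normr_gt0.
pose kap := lam' - lam.
have kap0 : 0 < kap by rewrite subr_gt0.
pose b := alpha * (`|lam| + 1).
have b0 : 0 <= b by rewrite mulr_ge0// addr_ge0.
(* [T] will satisfy [b * T <= M]; by the choice of [b], every [s0 <= T] then has [alpha * s0 <= 1]
   and [alpha * s0 * |lam| <= e / 2]. *)
pose M := Num.min (e / 2) (1 / 2).
have M0 : 0 < M by rewrite lt_min !divr_gt0.
pose T := Num.min (Num.min (d / 2) e) (Num.min (r / `|u|) (M / (b + 1))).
have T0 : 0 < T by rewrite !lt_min e0 !divr_gt0//; lra.
have [Td [Te [Tr TM]]] : T <= d / 2 /\ T <= e /\ T <= r / `|u| /\ T <= M / (b + 1).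
  by rewrite /T !ge_min !lexx ?orbT.
have bT : b * T <= M.
  have b1 : 0 < b + 1 by lra.
  move: TM; rewrite ler_pdivlMr//; nra.
have [Me M1] : M <= e / 2 /\ M <= 1 / 2 by rewrite /M !ge_min !lexx ?orbT.
pose y0 := fine (f xbar).
have fy0 : f xbar = y0%:E by rewrite /y0 fineK.
have fgrow s : 0 < s <= T -> ((y0 + lam' * s)%:E < f (xbar + s *: u)%R)%E.
  move=> /andP[s0 sT]; rewrite EFinD -fy0 ltNge -diffquot_le// -ltNge; apply: fd.
  by rewrite s0 /=; lra.
(* Below [T1] the term [lam * s1] costs at most [kap * T / 4], so [h s1 < y0 + 3 * kap * T / 4],
   while [h T > y0 + kap * T]: the minimum is not at [T]. *)
pose T1 := Num.min T (kap * T / (4 * (`|lam| + 1))).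
have lam1 : 0 < `|lam| + 1 by rewrite ltr_wpDl.
have T10 : 0 < T1 by rewrite lt_min T0 divr_gt0// mulr_gt0.
have [s1 /andP[s10 s1T1] fs1] : exists2 s, 0 < s < T1 &
    (f (xbar + s *: u)%R < (y0 + kap * T / 2)%:E)%E.
  apply: limf_einf_right_lt => //; rewrite -facc fy0 lte_fin ltrDl divr_gt0// mulr_gt0//.
have s1T : s1 < T by apply: lt_le_trans s1T1 _; rewrite /T1 ge_min lexx.
have s1l : `|lam| * s1 <= kap * T / 4.
  have : s1 <= kap * T / (4 * (`|lam| + 1)).
    by apply: le_trans (ltW s1T1) _; rewrite /T1 ge_min lexx orbT.
  by rewrite ler_pdivlMr ?mulr_gt0//; nra.
pose h s := (f (xbar + s *: u)%R + (- (lam * s))%:E)%E.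
have hl : lower_semicontinuous h.
  apply: lscD_lipschitz.
  - by move=> s; exact: fN.
  - move=> s y ys; have [V sV VP] := fl _ _ ys.
    exists [set s | V (xbar + s *: u)] => [|s' /VP//].
    have : (fun s : R => xbar + s *: u) @ s --> xbar + s *: u.
      by apply: cvgD; [exact: cvg_cst|apply: cvgZr_tmp; exact: cvg_id].
    exact.
  - exists `|lam| => x y; rewrite -normrM.
    have := ler_norm (- (lam * (x - y))); rewrite normrN; lra.
have [|s0] := lsc_compact_min hl (@segment_compact R s1 T).
  by exists s1; rewrite /= in_itv /= lexx ltW.
rewrite /= in_itv /= => /andP[s10' s0T] hmin.
have hs1 : (h s1 < (y0 + 3 * kap * T / 4)%:E)%E.
  rewrite /h; have := fN (xbar + s1 *: u); move: fs1.
  case: (f _) => // q; rewrite lte_fin => qy _.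
  rewrite -EFinD lte_fin; have := ler_norm (- (lam * s1)); rewrite normrN normrM (gtr0_norm s10).
  lra.
have hs0 : (h s0 <= h s1)%E by apply: hmin; rewrite /= in_itv /= lexx ltW.
have hT : ((y0 + kap * T)%:E < h T)%E.
  have TT : 0 < T <= T by rewrite T0 lexx.
  have := fgrow T TT; rewrite /h.
  case: (f (xbar + T *: u)) => [q| |] //; last by move=> _; rewrite addye// ltry.
  by rewrite -EFinD !lte_fin /kap; lra.
have {}s0T : s0 < T.
  rewrite lt_neqAle s0T andbT; apply/eqP => sT; move: hT; rewrite -sT.
  move/lt_le_trans => /(_ _ hs0) /lt_trans /(_ hs1); rewrite lte_fin.
  have : 0 < kap * T by rewrite mulr_gt0.
  by rewrite sT; lra.
have [m hm] : exists m, h s0 = m%:E.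
  have : h s0 \is a fin_num.
    rewrite fin_numElt; apply/andP; split.
      rewrite /h; have := fN (xbar + s0 *: u); case: (f _) => // q _.
      by rewrite -EFinD ltNyr.
    by apply: le_lt_trans hs0 _; apply: lt_trans hs1 _; rewrite ltry.
  by move=> hf0; exists (fine (h s0)); rewrite fineK.
have fs0 : f (xbar + s0 *: u) = (m + lam * s0)%:E.
  move: hm; rewrite /h; have := fN (xbar + s0 *: u); case: (f _) => // q _.
  by rewrite -EFinD => -[<-]; congr EFin; lra.
have fm s : s1 <= s <= T -> ((m + lam * s)%:E <= f (xbar + s *: u)%R)%E.
  move=> sT; have : (h s0 <= h s)%E by apply: hmin; rewrite /= in_itv.
  rewrite hm /h; have := fN (xbar + s *: u); case: (f _) => [q _||] //.
    by rewrite -EFinD !lee_fin; lra.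
  by move=> _ _; rewrite leey.
have s0_gt0 : 0 < s0 by exact: lt_le_trans s10'.
have H e' : 0 < e' -> exists x xs, [/\ D f x xs, ball (xbar + s0 *: u) e' x,
     - e' < xs (xbar + s0 *: u - x) & lam - e' < xs u].
  move=> e'0.
  have sE (s : R) : xbar + s1 *: u + (s - s1) *: u = xbar + s *: u.
    by rewrite -addrA -scalerDl (addrCA s1) subrr addr0.
  have := @subdiff_mean_value R X D f (xbar + s1 *: u) u lam (T - s1)
    (m + lam * s1) (s0 - s1) e' hD fN fl u0; rewrite sE; apply => //.
  - by rewrite subr_ge0 s10' ltrD2r.
  - move=> s /andP[s_0 s_T].
    have := sE (s + s1); rewrite addrK => ->.
    rewrite (_ : _ + lam * s = m + lam * (s + s1)); last by ring.
    by apply: fm; apply/andP; split; lra.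
  - by rewrite fs0; congr EFin; ring.
have Oc : Omega (xbar + s0 *: u).
  apply: xO; rewrite -ball_normE /= opprD addrA subrr add0r normrN normrZ gtr0_norm//.
  by rewrite -ltr_pdivlMr//; exact: lt_le_trans Tr.
have as0 : alpha * s0 <= 1.
  have : alpha * s0 <= b * T.
    apply: ler_pM => //; [exact: ltW| |exact: ltW].
    by rewrite /b ler_peMr// lerDr.
  lra.
have al : alpha * s0 * `|lam| <= e / 2.
  have : alpha * s0 * `|lam| <= b * T.
    rewrite mulrAC; apply: ler_pM; rewrite ?mulr_ge0//; try exact: ltW.
    by rewrite /b ler_wpM2l//; lra.
  lra.
(* Directional convergence requires an error relative to the distance [s0] already travelled. *)
have e2 : 0 < Num.min (e * s0) (e / 2) by rewrite lt_min mulr_gt0//= divr_gt0.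
have [x [xx gx' rx]] := @radsubder_transfer xbar u alpha s0 lam alpha0 (ltW s0_gt0) as0 Oc H _ e2.
exists s0, x; split => //.
- by rewrite s0_gt0 /=; exact: lt_le_trans Te.
- move: xx; rewrite -ball_normE /= lt_min distrC opprD addrA => /andP[? _].
  exact: ltW.
- apply: le_trans rx; rewrite lee_fin.
  have : Num.min (e * s0) (e / 2) <= e / 2 by rewrite ge_min lexx orbT.
  have : alpha * s0 * lam <= alpha * s0 * `|lam|.
    by rewrite ler_wpM2l ?ler_norm// mulr_ge0// ltW.
  lra.
Qed.

End SubdifferentialInclusion.

(** * Monotonicity along a segment *)

Lemma limf_einf_right_ge (R : realType) (h : R -> \bar R) (l : \bar R) (e : R) :
  0 < e -> (forall t, 0 < t < e -> (l <= h t)%E) -> (l <= limf_einf h 0^'+)%E.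
Proof.
move=> e0 H; rewrite leNgt; apply/negP => /limf_einf_right_lt/(_ e0)[t te].
by rewrite ltNge H.
Qed.

(** Otherwise the quotients of [f] exceed those of [g] by [e] near 0, and so do the lower limits.
    Finiteness of one of them makes this gap contradictory; it would not be if both were equal to
    the same infinity. *)
Lemma radsubder_le_quotient (R : realType) (X : normedModType R)
    (f g : X -> \bar R) (x u : X) (d e : R) :
  (radsubder f x u <= radsubder g x u)%E ->
  radsubder f x u \is a fin_num \/ radsubder g x u \is a fin_num ->
  0 < d -> 0 < e ->
  exists2 t, 0 < t < d & (diffquot f x u t < diffquot g x u t + e%:E)%E.
Proof.
move=> fg fin d0 e0; apply: contrapT => H.
have {}H t : 0 < t < d -> (diffquot g x u t + e%:E <= diffquot f x u t)%E.
  by move=> td; rewrite leNgt; apply/negP => ?; apply: H; exists t.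
have K (r : R) : (r%:E < radsubder g x u)%E -> ((r + e)%:E <= radsubder f x u)%E.
  move=> /limf_einf_right_gt[d' d'0 rg].
  apply: (@limf_einf_right_ge _ _ _ (Num.min d d')); first by rewrite lt_min d0.
  move=> t /andP[t0]; rewrite lt_min => /andP[td td'].
  apply: le_trans (H t _); last by rewrite t0.
  by rewrite EFinD leeD2r// ltW// rg// t0.
have [l [lg lf]] : exists l : R,
    ((l - e / 2)%:E < radsubder g x u)%E /\ (radsubder f x u <= l%:E)%E.
  case: fin => [ff|gf].
    exists (fine (radsubder f x u)); rewrite fineK//; split => //.
    by apply: lt_le_trans fg; rewrite -[ltRHS]fineK// lte_fin; lra.
  exists (fine (radsubder g x u)); rewrite fineK//; split => //.
  by rewrite -[ltRHS]fineK// lte_fin; lra.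
by have := le_trans (K _ lg) lf; rewrite lee_fin; lra.
Qed.

(** Continuous induction with slack [e * s]: the set [S] of parameters where the bound holds
    contains its supremum, and [step] would go beyond a supremum below 1. *)
Lemma lsc_dini_le (R : realType) (F G : R -> \bar R) :
  no_ninfty F -> lower_semicontinuous F ->
  (forall t, t \in `[0, 1] -> G t \is a fin_num) ->
  {within `[0, 1], continuous G} ->
  (forall s d e : R, 0 <= s < 1 -> F s \is a fin_num -> 0 < d -> 0 < e ->
     exists2 t, 0 < t < d &
       (F (s + t)%R <= F s + (fine (G (s + t)%R) - fine (G s) + e * t)%:E)%E) ->
  (F 1%R <= F 0%R + (fine (G 1%R) - fine (G 0%R))%:E)%E.
Proof.
move=> FN Fl Gfin Gc step.
have := FN 0; case F0 : (F 0) => [k0| |] // _; last by rewrite addye// leey.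
apply/lee_addgt0Pr => e e0.
pose k := k0 - fine (G 0).
pose S := [set s | 0 <= s <= 1 /\ (F s <= (k + fine (G s) + e * s)%:E)%E].
have S0 : S 0.
  by split; [rewrite lexx ler01|rewrite F0 lee_fin /k mulr0; lra].
have supS : has_sup S.
  by split; [exists 0|exists 1 => s [/andP[_ s1] _]].
pose s := sup S.
have s0 : 0 <= s by apply: (sup_upper_bound supS).
have s1 : s <= 1.
  by apply: ge_sup; [exists 0|move=> r [/andP[]]].
have sI : s \in `[0, 1] by rewrite in_itv /= s0.
(* If the bound failed at [s], a real [b] would separate the two sides; lower semicontinuity of [F]
   and continuity of [G] would make it fail at points of [S] close to [s]. *)
have Ss : S s.
  split; first by rewrite s0.
  rewrite leNgt; apply/negP => /lte_real_between[b [kb bF]].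
  rewrite lte_fin in kb.
  have [V /nbhs_ballP[r1 r10 sV] VP] := Fl _ _ bF.
  have : \forall r \near within `[0, 1]%classic (nbhs s), (G r < (b - k - e * s)%:E)%E.
    have Gs : G @ within `[0, 1]%classic (nbhs s) --> G s.
      exact: (subspace_continuousP _ _).1 Gc s sI.
    apply: (Gs [set x | (x < (b - k - e * s)%:E)%E]).
    apply: open_nbhs_nbhs; split; first exact: open_ereal_lt_ereal.
    by rewrite /= -[ltLHS]fineK ?Gfin// lte_fin; lra.
  move=> /nbhs_ballP[r2 r20 sG].
  have r0 : 0 < Num.min r1 r2 by rewrite lt_min r10.
  have [r Sr sr] := sup_adherent r0 supS.
  have rs : r <= s by apply: (sup_upper_bound supS).
  have [/andP[r_0 r_1] Fr] := Sr.
  have sr' : `|s - r| < Num.min r1 r2 by rewrite ger0_norm ?subr_ge0//; rewrite -/s in sr; lra.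
  rewrite lt_min in sr'; case/andP: sr' => sr1 sr2.
  have rI : r \in `[0, 1] by rewrite in_itv /= r_0.
  have := sG r; rewrite -ball_normE /= => /(_ sr2 rI) Gr.
  have bFr : (b%:E < F r)%E by apply: VP; apply: sV; rewrite -ball_normE.
  have := lt_le_trans bFr Fr; rewrite -(fineK (Gfin r rI)) !lte_fin in Gr *.
  have : e * r <= e * s by rewrite ler_pM2l.
  rewrite /=; lra.
have [sE|sn] := eqVneq s 1.
  by have [_] := Ss; rewrite sE -!EFinD !mulr1 => /le_trans; apply; rewrite lee_fin /k; lra.
have s1' : s < 1 by rewrite lt_neqAle sn.
have Fsf : F s \is a fin_num.
  have [_ Fs] := Ss; rewrite fin_numElt FN /=; apply: le_lt_trans Fs _; exact: ltry.
have s1d : 0 < 1 - s by rewrite subr_gt0.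
have sI' : 0 <= s < 1 by rewrite s0.
have [t /andP[t0 t1] Ft] := step s (1 - s) e sI' Fsf s1d e0.
have Sst : S (s + t).
  split; first by apply/andP; split; lra.
  apply: (le_trans Ft); have [_] := Ss; rewrite -(fineK Fsf) -EFinD !lee_fin; lra.
have : s + t <= s by apply: (sup_upper_bound supS).
by rewrite gerDl leNgt t0.
Qed.

Lemma no_increase_on_segment (R : realType) (X : normedModType R)
    (f g : X -> \bar R) (x u : X) :
  no_ninfty f -> lower_semicontinuous f ->
  (forall t : R, t \in `[0, 1] -> g (x + t *: u) \is a fin_num) ->
  {within `[0, 1], continuous (fun t : R => g (x + t *: u))} ->
  (forall t : R, t \in `[0, 1[ -> edom f (x + t *: u) ->
     (radsubder f (x + t *: u)%R u <= radsubder g (x + t *: u)%R u)%E /\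
     (radsubder f (x + t *: u) u \is a fin_num \/
      radsubder g (x + t *: u) u \is a fin_num)) ->
  (f (x + u)%R <= f x + (fine (g (x + u)%R) - fine (g x))%:E)%E.
Proof.
move=> fN fl gfin gc fgle.
have := @lsc_dini_le R (fun t => f (x + t *: u)) (fun t => g (x + t *: u)).
rewrite scale1r scale0r addr0; apply => //.
- move=> s b fb; have [V sV VP] := fl _ _ fb.
  exists [set s | V (x + s *: u)] => [|s' /VP//].
  have : (fun s : R => x + s *: u) @ s --> x + s *: u.
    by apply: cvgD; [exact: cvg_cst|apply: cvgZr_tmp; exact: cvg_id].
  exact.
- move=> s d e sI fs d0 e0.
  have sdom : edom f (x + s *: u) by rewrite /edom /= ltey; case: (f _) fs.
  have [|fg fin] := fgle s _ sdom; first by rewrite in_itv.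
  have m0 : 0 < Num.min d (1 - s).
    by rewrite lt_min d0 subr_gt0; case/andP: sI.
  have [t /andP[t0 td] ft] := radsubder_le_quotient fg fin m0 e0.
  move: td; rewrite lt_min => /andP[td ts].
  exists t; first by rewrite t0.
  have [/andP[s0 s1]] := sI.
  have gs : g (x + s *: u) \is a fin_num by apply: gfin; rewrite in_itv /= s0 ltW.
  have gt : g (x + (s + t) *: u) \is a fin_num.
    by apply: gfin; rewrite in_itv /=; apply/andP; split; lra.
  have xst : x + s *: u + t *: u = x + (s + t) *: u by rewrite scalerDl addrA.
  move: ft; rewrite /diffquot xst -(fineK gs) -(fineK gt) -(fineK fs).
  (* The value [+oo] at the new point would make the quotient [+oo], against the strict
     inequality. *)
  have := fN (x + (s + t) *: u); case: (f (x + (s + t) *: u)) => [y _| |] //; last first.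
    rewrite addye// gt0_mulye ?lte_fin ?invr_gt0//.
  rewrite -!EFinB -!EFinM -!EFinD lte_fin lee_fin.
  by rewrite -(ltr_pM2r t0) [ltRHS]mulrDl !divfK ?gt_eqF//; lra.
Qed.

(** * Constancy of [f - g] *)

Theorem theorem11 (R : realType) (X : completeNormedModType R)
    (D : subdiff_operator X) (Omega : set X) (f g : X -> \bar R)
    (hD : is_subdifferential D)
    (hOmega0 : Omega !=set0) (hOmega_open : open Omega)
    (hOmega_convex : convex_set Omega)
    (hf : proper_lsc f) (hg : proper_lsc g)
    (hOmegaf : (Omega `&` edom f) !=set0)
    (hfg : forall xbar u : X,
      (Omega `&` subdiff_dom D f `&` subdiff_dom D g) xbar ->
      u != 0 -> (Omega `&` edom f `&` edom g) (xbar + u) ->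
      ((forall t : R, t \in `[0, 1] -> g (xbar + t *: u) \is a fin_num) /\
       {within `[0, 1], continuous (fun t : R => g (xbar + t *: u))}) /\
      (forall t : R, t \in `[0, 1[ ->
         (radsubder_finite f (xbar + t *: u) u \/
          radsubder_finite g (xbar + t *: u) u) /\
         ((radially_accessible f (xbar + t *: u) u /\
           upper_semismooth g (xbar + t *: u) u) \/
          strictly_upper_semismooth g (xbar + t *: u) u))) :
  (forall x : X, (Omega `&` edom f) x -> D f x `<=` D g x) ->
  exists c : R, forall x : X, (Omega `&` edom f) x -> f x = (g x + c%:E)%E.
Proof.
move=> DfDg; have [fN _ fl] := hf; have [gN _ gl] := hg; have [Dsub sepD] := hD.
have domD h y : proper_lsc h -> subdiff_dom D h y -> edom h y.
  by move=> hh [xs Dxs]; have [] := (Dsub h hh y).2 _ Dxs.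
(* Only the starting point has to be in [subdiff_dom D f]. When both points are, exchanging them
   gives equality, which is [cE]. *)
have le_at x y : Omega x -> subdiff_dom D f x -> Omega y -> edom f y ->
    edom g y -> fine (f y) - fine (g y) <= fine (f x) - fine (g x).
  move=> Ox [xs Dxs] Oy fy gy.
  have fx : edom f x by apply: domD => //; exists xs.
  have Dgx : subdiff_dom D g x by exists xs; exact: (DfDg x).
  have gx : edom g x by exact: domD.
  have [->//|yx] := eqVneq y x.
  have u0 : y - x != 0 by rewrite subr_eq0.
  have xy : x + (y - x) = y by rewrite addrCA subrr addr0.
  have xD : (Omega `&` subdiff_dom D f `&` subdiff_dom D g) x.
    by split => //; split => //; exists xs.
  have yD : (Omega `&` edom f `&` edom g) (x + (y - x)) by rewrite xy.
  have [[gfin gc] seg] := hfg x (y - x) xD u0 yD.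
  have segO t : t \in `[0, 1[ -> Omega (x + t *: (y - x)).
    rewrite in_itv /= => /andP[t0 /ltW t1].
    have -> : x + t *: (y - x) = t *: y + (1 - t) *: x.
      by rewrite scalerBr scalerBl scale1r addrCA.
    exact: (set_mem (hOmega_convex y x (Itv01 t0 t1) (mem_set Oy) (mem_set Ox))).
  have := @no_increase_on_segment R X f g x (y - x) fN fl gfin gc.
  rewrite xy => H; have {}H : (f y <= f x + (fine (g y) - fine (g x))%:E)%E.
    apply: H => t tI ft.
    have [fin sm] := seg t tI; split; last by case: fin => -[]; [left|right].
    have Ot := segO t tI.
    case: sm => [[acc sm]|sm].
      exact: (radsubder_le_accessible hD hOmega_open hf hg).
    exact: (radsubder_le_strict hD hOmega_open hf hg).
  move: H; rewrite -(fineK (edom_fin_num fN fx)) -(fineK (edom_fin_num fN fy)).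
  by rewrite -EFinD lee_fin /=; lra.
have dense y e : Omega y -> edom f y -> 0 < e -> exists x,
    [/\ Omega x, subdiff_dom D f x, ball y e x & (f x < f y + e%:E)%E].
  move=> Oy fy e0.
  have /nbhs_ballP[r r0 yO] := open_nbhs_nbhs (conj hOmega_open Oy).
  have m0 : 0 < Num.min e r by rewrite lt_min e0.
  have [x [Dx yx fx]] := subdiff_dom_dense sepD fN fl fy m0.
  exists x; split => //.
  - by apply: yO; apply: le_ball yx; rewrite ge_min lexx orbT.
  - by apply: le_ball yx; rewrite ge_min lexx.
  - by apply: (lt_le_trans fx); rewrite leeD2l// lee_fin ge_min lexx.
have [y0 [Oy0 fy0]] := hOmegaf.
have [x0 [Ox0 Dx0 _ _]] := dense y0 1 Oy0 fy0 ltr01.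
pose c := fine (f x0) - fine (g x0).
have domg x : Omega x -> subdiff_dom D f x -> edom f x /\ edom g x.
  move=> Ox [xs Dxs]; have fx : edom f x by apply: domD => //; exists xs.
  by split => //; apply: domD => //; exists xs; exact: (DfDg x).
have cE x : Omega x -> subdiff_dom D f x -> fine (f x) - fine (g x) = c.
  move=> Ox Dx; have [fx gx] := domg x Ox Dx; have [fx0 gx0] := domg x0 Ox0 Dx0.
  by apply/eqP; rewrite eq_le !le_at.
exists c => y [Oy fy].
have fyf := edom_fin_num fN fy.
(* Also puts [y] in the domain of [g], as [le_at] requires. If [g y] were larger, lower
   semicontinuity would keep [g] above [b] near [y], yet [dense] gives [x] there with
   [g x = f x - c < b]. *)
have gy_le : (g y <= (fine (f y) - c)%:E)%E.
  rewrite leNgt; apply/negP => /lte_real_between[b [fb bg]].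
  rewrite lte_fin in fb.
  have [V /nbhs_ballP[r r0 yV] VP] := gl _ _ bg.
  pose e := Num.min r (b - (fine (f y) - c)).
  have e0 : 0 < e by rewrite lt_min r0 subr_gt0.
  have [er eb] : e <= r /\ e <= b - (fine (f y) - c) by rewrite /e !ge_min !lexx ?orbT.
  have [x [Ox Dx yx fx]] := dense y e Oy fy e0.
  have [fxd gxd] := domg x Ox Dx.
  have := cE x Ox Dx; have := VP x (yV x (le_ball er yx)); move: fx.
  rewrite -(fineK fyf) -(fineK (edom_fin_num fN fxd)) -(fineK (edom_fin_num gN gxd)).
  by rewrite -EFinD !lte_fin /=; lra.
have gy : edom g y by apply: (le_lt_trans gy_le); exact: ltry.
have gyf := edom_fin_num gN gy.
have := le_at x0 y Ox0 Dx0 Oy fy gy; rewrite -/c => le1.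
move: gy_le; rewrite -(fineK fyf) -(fineK gyf) lee_fin -EFinD /= => le2.
by congr EFin; lra.
Qed.
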